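(* In the setting described in the context, fix $t\in\mathbb{Z}_+$ and $\delta\in(0,1)$, and run the Adaptive Rolling Window procedure with $\delta'=\delta/(3t)$ and $M=b-a$. With probability at least $1-\delta$, its output satisfies $$|\widehat\mu_{t,\widehat k}-\mu_t|\le 3\min_{k\in[t]}\left\{3\sqrt{\log(6t/\delta)}\max_{t-k+1\le j\le t}|\mu_j-\mu_t|+\sigma_{t,k}\sqrt{\frac{2\log(6t/\delta)}{B_{t,k}}}+\frac{10(b-a)\log(6t/\delta)}{B_{t,k}}\right\}.$$
   Context: Let $a<b$ be real numbers and $t\in\mathbb{Z}_+$. For each $j\in[t]$ let $\mathcal{Q}_j$ be a probability distribution on $[a,b]$ with mean $\mu_j$ and variance $\sigma_j^2$, and let $B_j\ge 1$ be an integer. The data are $\mathcal{D}_j=\{u_{j,i}\}_{i=1}^{B_j}$, $j\in[t]$, where all $u_{j,i}$ are mutually independent and $u_{j,i}\sim\mathcal{Q}_j$. For $k\in[t]$ define $B_{t,k}=\sum_{j=t-k+1}^t B_j$, $\sigma_{t,k}^2=\frac{1}{B_{t,k}}\sum_{j=t-k+1}^t B_j\sigma_j^2$, $\widehat{\mu}_{t,k}=\frac{1}{B_{t,k}}\sum_{j=t-k+1}^t\sum_{i=1}^{B_j}u_{j,i}$, and when $B_{t,k}\ge2$, $\widehat v_{t,k}^2=\frac{1}{B_{t,k}-1}\sum_{j=t-k+1}^t\sum_{i=1}^{B_j}(u_{j,i}-\widehat\mu_{t,k})^2$ with $\widehat v_{t,k}\ge0$. For $\delta'\in(0,1)$ and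 $M>0$ define $$\widehat\psi(t,k,\delta')=\begin{cases} M, & B_{t,k}=1,\\ \widehat v_{t,k}\sqrt{\frac{2\log(2/\delta')}{B_{t,k}}}+\frac{8M\log(2/\delta')}{3(B_{t,k}-1)}, & B_{t,k}\ge 2,\end{cases}\qquad \widehat\phi(t,k,\delta')=\max_{i\in[k]}\Big(|\widehat\mu_{t,k}-\widehat\mu_{t,i}|-\big[\widehat\psi(t,k,\delta')+\widehat\psi(t,i,\delta')\big]\Big)_+ ,$$ where $x_+=\max\{x,0\}$. The Adaptive Rolling Window procedure with hyperparameters $\delta',M$ computes these quantities for all $k\in[t]$, chooses any $\widehat k\in\mathop{\mathrm{argmin}}_{k\in[t]}\{\widehat\phi(t,k,\delta')+\widehat\psi(t,k,\delta')\}$, and outputs $\widehat\mu_{t,\widehat k}$. *)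

(* Defs.v *)
From HB Require Import structures.
From mathcomp Require Import all_boot all_order all_algebra.
From mathcomp Require Import all_classical all_reals all_analysis.
Set Implicit Arguments. Unset Strict Implicit. Unset Printing Implicit Defensive.
Import Order.TTheory GRing.Theory Num.Theory.
Import numFieldNormedType.Exports.
Local Open Scope classical_set_scope.
Local Open Scope ring_scope.

Section ARW.
Variable R : realType.

Definition dist_mean (Q : probability R R) : R := fine (\int[Q]_x (x%:E))%E.
Definition dist_var (Q : probability R R) : R :=
  fine (\int[Q]_x (((x - dist_mean Q) ^+ 2)%:E))%E.

Definition mutually_independent d (T : measurableType d) (P : probability T R)
  (I : eqType) (S : set I) (X : I -> T -> R) : Prop :=
  forall (F : seq I) (A : I -> set R),
    uniq F -> (forall i, i \in F -> S i) -> (forall i, measurable (A i)) ->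
    P (\bigcap_(i in [set` F]) (X i @^-1` A i)) =
      (\prod_(i <- F) P (X i @^-1` A i))%E.

(* Rolling-window statistics, for a fixed outcome: u j i is the i-th sample of
   period j (j in 1..t, i in 1..B j). Windows are k = 1..t, covering periods
   t-k+1 .. t. *)
Definition Btk (B : nat -> nat) (t k : nat) : nat :=
  (\sum_(t - k + 1 <= j < t.+1) B j)%N.

Definition window_sum (u : nat -> nat -> R) (B : nat -> nat) (t k : nat) : R :=
  \sum_(t - k + 1 <= j < t.+1) \sum_(1 <= i < (B j).+1) u j i.

Definition muhat (u : nat -> nat -> R) (B : nat -> nat) (t k : nat) : R :=
  (Btk B t k)%:R^-1 * window_sum u B t k.

Definition vhat (u : nat -> nat -> R) (B : nat -> nat) (t k : nat) : R :=
  Num.sqrt (((Btk B t k)%:R - 1)^-1 *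
    \sum_(t - k + 1 <= j < t.+1) \sum_(1 <= i < (B j).+1)
       (u j i - muhat u B t k) ^+ 2).

Definition psihat (u : nat -> nat -> R) (B : nat -> nat) (dl M : R) (t k : nat) : R :=
  if (Btk B t k <= 1)%N then M
  else vhat u B t k * Num.sqrt (2 * ln (2 / dl) / (Btk B t k)%:R)
       + 8 * M * ln (2 / dl) / (3 * ((Btk B t k)%:R - 1)).

Definition phihat (u : nat -> nat -> R) (B : nat -> nat) (dl M : R) (t k : nat) : R :=
  \big[Num.max/0]_(1 <= i < k.+1)
     Num.max (`|muhat u B t k - muhat u B t i|
              - (psihat u B dl M t k + psihat u B dl M t i)) 0.

Definition arw_argmin (u : nat -> nat -> R) (B : nat -> nat) (dl M : R) (t khat : nat) : Prop :=
  (1 <= khat <= t)%N /\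
  forall k, (1 <= k <= t)%N ->
    phihat u B dl M t khat + psihat u B dl M t khat
      <= phihat u B dl M t k + psihat u B dl M t k.

Definition sigma2tk (sigma2 : nat -> R) (B : nat -> nat) (t k : nat) : R :=
  (Btk B t k)%:R^-1 * \sum_(t - k + 1 <= j < t.+1) (B j)%:R * sigma2 j.

Definition min_range (f : nat -> R) (t : nat) : R :=
  \big[Num.min/f 1%N]_(1 <= k < t.+1) f k.

Definition drift (mu : nat -> R) (t k : nat) : R :=
  \big[Num.max/0]_(t - k + 1 <= j < t.+1) `|mu j - mu t|.

End ARW.

(* Main.v *)
Require Import Defs.
From HB Require Import structures.
From mathcomp Require Import all_boot all_order all_algebra.
From mathcomp Require Import all_classical all_reals all_analysis.
From mathcomp Require Import measurable_realfun finmap ring lra.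
Import Order.TTheory GRing.Theory Num.Theory.
Import numFieldNormedType.Exports.
Local Open Scope classical_set_scope.
Local Open Scope ring_scope.

(** Goldenshluger-Lepski selection on top of an empirical Bernstein inequality.

    On a window of [n] samples put [r = L / n], let [mb] be the average mean and
    [alpha] the average of [sigma_j^2 + (mu_j - mb)^2].  Bernstein's inequality
    is applied to the sums of [x - mb] (both signs), of [(x - mb)^2 - alpha] and
    of its opposite.  Since [sum (x - xbar)^2 = sum (x - mb)^2 - n (xbar - mb)^2],
    the last two control the sample variance from both sides.  This costs
    [4 exp(-L)] per window, less than the [6 exp(-L) = delta / t] available, and
    no concentration inequality for the sample standard deviation is needed:
    either [sqrt alpha] is at most [7/6 sqrt (2 r)], and then the linear term
    [8 r / 3] alone dominates the deviation, or [sqrt alpha] exceeds the sample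
    standard deviation by at most [7/6 sqrt (2 r)].  On the resulting event
    [|muhat_k - mb_k| <= psihat_k], hence [phihat_k <= 2 drift_k], and comparing
    the selected window with any window [k] bounds the error by
    [5 drift_k + 3 psihat_k]. *)

(** * Expectation of products of independent variables *)

Import HBNNSimple.

(** Level-set expansion of a simple function, in the form that carries an identity known for
    indicators over to [h] composed with [U]. *)
Lemma integral_nnsfun_comp (d : measure_display) (T : measurableType d)
  (R : realType) (mu : {measure set T -> \bar R}) (G U : T -> R)
  (h : {nnsfun R >-> R}) (s := fset_set (range h)) :
  measurable_fun setT G -> (forall t, 0 <= G t) -> measurable_fun setT U ->
  (\int[mu]_t (G t * h (U t))%:E =
   \sum_(i < #|` s|) (s`_i)%:E *
      \int[mu]_t (G t * \1_(h @^-1` [set s`_i]) (U t))%:E)%E.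
Proof.
move=> mG G0 mU.
have s0 (i : 'I_#|` s|) : 0 <= s`_i.
  have : s`_i \in s by apply: mem_nth.
  rewrite in_fset_set//. by rewrite in_setE => -[x _ <-].
have m1 (i : 'I_#|` s|) : measurable_fun setT
    (fun t => (G t * \1_(h @^-1` [set s`_i]) (U t))%:E : \bar R).
  apply/measurable_EFinP/measurable_funM => //.
  by apply: measurableT_comp => //; exact: measurable_indic.
under eq_integral => t _.
  rewrite fimfunEord -/s mulr_sumr -sumEFin.
  under eq_bigr do rewrite mulrCA EFinM.
  over.
rewrite ge0_integral_sum//; last 2 first.
- by move=> i; exact: measurable_funeM.
- by move=> i t _; rewrite mule_ge0// lee_fin ?mulr_ge0// indicE.
apply: eq_bigr => i _; rewrite ge0_integralZl_EFin//.
by move=> t _; rewrite lee_fin mulr_ge0// indicE.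
Qed.

(** The standard machine: a factorisation known for indicators passes to simple functions by
    linearity, then to [f] by monotone convergence. *)
Lemma ge0_integral_comp_factor (d : measure_display) (T : measurableType d)
  (R : realType) (mu : {measure set T -> \bar R}) (G U : T -> R) (c : R)
  (f : R -> R) :
  measurable_fun setT G -> (forall t, 0 <= G t) -> measurable_fun setT U ->
  0 <= c -> measurable_fun setT f -> (forall x, 0 <= f x) ->
  (forall A, measurable A ->
     (\int[mu]_t (G t * \1_A (U t))%:E = c%:E * \int[mu]_t (\1_A (U t))%:E)%E) ->
  (\int[mu]_t (G t * f (U t))%:E = c%:E * \int[mu]_t (f (U t))%:E)%E.
Proof.
move=> mG G0 mU c0 mf f0 H.
have mf' : measurable_fun setT (EFin \o f) by exact/measurable_EFinP.
pose h := nnsfun_approx measurableT mf'.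
have hcvg x : h n x @[n --> \oo] --> f x.
  have /fine_cvgP[_] := @cvg_nnsfun_approx _ _ _ _ measurableT _ mf'
    (fun x _ => f0 x) x Logic.I.
  exact: cvg_trans.
have hmono x : {homo h^~ x : n m / (n <= m)%N >-> n <= m}.
  by move=> n m nm; exact/lefP/nd_nnsfun_approx.
(* Stated for a general factor [g], to be used both with [G] and with the constant 1. *)
have approx (g : T -> R) : measurable_fun setT g -> (forall t, 0 <= g t) ->
    (\int[mu]_t (g t * h n (U t))%:E @[n --> \oo] -->
     \int[mu]_t (g t * f (U t))%:E)%E.
  move=> mg g0.
  under [X in _ --> X]eq_integral => t _.
    rewrite (_ : (_ * _)%:E = limn (fun n => (g t * h n (U t))%:E)); last first.
      apply/esym/cvg_lim => //; apply/cvg_EFin; first by near=> n.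
      by apply: cvgMr; exact: hcvg.
    over.
  apply: cvg_monotone_convergence => //.
  - move=> n; apply/measurable_EFinP/measurable_funM => //.
    exact: measurableT_comp.
  - by move=> n t _; rewrite lee_fin mulr_ge0.
  - by move=> t _ n m nm; rewrite lee_fin ler_wpM2l// hmono.
have cvgG := approx G mG G0.
have cvg1 := approx (cst 1) (measurable_cst _) (fun=> ler01).
have eqh n : (\int[mu]_t (G t * h n (U t))%:E =
    c%:E * \int[mu]_t (cst 1 t * h n (U t))%:E)%E.
  rewrite !integral_nnsfun_comp// ge0_sume_distrr; last first.
    move=> i _; apply: mule_ge0.
      rewrite lee_fin.
      have : (fset_set (range (h n)))`_i \in fset_set (range (h n)) by apply: mem_nth.
      by rewrite in_fset_set// in_setE => -[x _ <-].
    by apply: integral_ge0 => t _; rewrite lee_fin mulr_ge0//= indicE.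
  apply: eq_bigr => i _; rewrite H; last exact: measurable_funPTI.
  by rewrite muleCA; do 2 congr (_ * _)%E; apply: eq_integral => t _; rewrite mul1r.
have := cvgeZl (erefl : c%:E \is a fin_num) cvg1.
under eq_fun do rewrite -eqh.
move=> /(cvg_unique _ cvgG) -> //.
by congr (_ * _)%E; apply: eq_integral => t _; rewrite mul1r.
Unshelve. all: by end_near. Qed.

Section independence.
Context (d : measure_display) (T : measurableType d) (R : realType)
  (P : probability T R) (I : eqType) (S : set I) (X : I -> T -> R).
Hypothesis mX : forall i, measurable_fun setT (X i).
Hypothesis indepX : mutually_independent P S X.

Let p (A : I -> set R) i : R := fine (P (X i @^-1` A i)).

Let measurable_preX A i : measurable (A i) -> measurable (X i @^-1` A i).
Proof. by move=> mA; rewrite -[_ @^-1` _]setTI; exact: mX. Qed.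

Lemma prod_indic_preimage (F : seq I) (A : I -> set R) (t : T) :
  \prod_(i <- F) \1_(A i) (X i t) =
  \1_(\bigcap_(i in [set` F]) (X i @^-1` A i)) t :> R.
Proof.
rewrite [RHS]indicE; elim: F => [|i F IH].
  by rewrite big_nil mem_set//= => i.
rewrite big_cons IH indicE -natrM mulnb; congr (_ %:R); congr nat_of_bool.
apply/andP/idP => [[/set_mem Ai /set_mem AF]|/set_mem A0].
  apply/mem_set => j /=; rewrite inE => /predU1P[->//|jF]; exact: AF.
split; apply/mem_set; first by apply: (A0 i) => /=; rewrite mem_head.
by move=> j /= jF; apply: (A0 j) => /=; rewrite inE jF orbT.
Qed.

(* The functions [f i] replace the indicators one index at a time, so that each
   step only varies the law of a single variable. *)
Lemma indep_integral_prod_indic (F1 F2 : seq I) (f : I -> R -> R) (e : I -> R)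
  (A : I -> set R) :
  uniq (F1 ++ F2) -> (forall i, i \in F1 ++ F2 -> S i) ->
  (forall i, measurable (A i)) ->
  (forall i, measurable_fun setT (f i)) -> (forall i x, 0 <= f i x) ->
  (forall i, i \in F1 -> \int[P]_t (f i (X i t))%:E = (e i)%:E)%E ->
  (\int[P]_t (\prod_(i <- F1) f i (X i t) * \prod_(i <- F2) \1_(A i) (X i t))%:E
   = (\prod_(i <- F1) e i * \prod_(i <- F2) p A i)%:E)%E.
Proof.
move=> + + + mf f0; elim: F1 F2 A => [|i F1 IH] F2 A.
  move=> uF FS mA _; rewrite big_nil mul1r.
  under eq_integral do rewrite big_nil mul1r prod_indic_preimage.
  rewrite integral_indic//; last first.
    by apply: fin_bigcap_measurable => // j _; exact: measurable_preX.
  rewrite setIT [LHS](indepX F2 _ uF FS mA).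
  rewrite (big_morph EFin (id1 := 1%E) (op1 := mule))//.
  apply: eq_bigr => j _; rewrite /p fineK//; apply: fin_num_measure; exact: measurable_preX.
move=> uF FS mA fe.
pose G t := \prod_(j <- F1) f j (X j t) * \prod_(j <- F2) \1_(A j) (X j t).
pose c := \prod_(j <- F1) e j * \prod_(j <- F2) p A j.
have e0 j : j \in i :: F1 -> 0 <= e j.
  by move=> jF; rewrite -lee_fin -fe//; apply: integral_ge0 => t _; rewrite lee_fin.
transitivity (\int[P]_t (G t * f i (X i t))%:E)%E.
  by apply: eq_integral => t _; rewrite big_cons /G; congr EFin; ring.
have G0 t : 0 <= G t.
  by rewrite mulr_ge0// prodr_ge0// => j _; rewrite indicE.
have c0 : 0 <= c.
  rewrite /c mulr_ge0//; last by rewrite prodr_ge0// => j _; rewrite fine_ge0.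
  by rewrite big_seq prodr_ge0// => j jF; rewrite e0// inE jF orbT.
have mG : measurable_fun setT G.
  apply: measurable_funM; apply: measurable_prod => j _.
    exact: measurableT_comp.
  by apply: measurableT_comp => //; exact: measurable_indic.
rewrite (@ge0_integral_comp_factor _ _ _ _ G (X i) c)//.
  by rewrite fe ?mem_head// -EFinM big_cons /c; congr EFin; ring.
move=> B mB.
have iF2 : i \notin F2 by move: uF => /= /andP[]; rewrite mem_cat negb_or => /andP[].
have iF1 : i \notin F1 by move: uF => /= /andP[]; rewrite mem_cat negb_or => /andP[].
(* The index [i] moves from the functions to the indicators, with set [B], so that the induction
   hypothesis applies to [F1] and [i :: F2]. *)
pose A' j := if j == i then B else A j.
have A'F j : j \in F2 -> A' j = A j.
  by rewrite /A'; case: eqP => // ->; rewrite (negbTE iF2).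
transitivity (\int[P]_t (\prod_(i <- F1) f i (X i t) *
    \prod_(i <- i :: F2) \1_(A' i) (X i t))%:E)%E.
  apply: eq_integral => t _; rewrite /G big_cons {1}/A' eqxx.
  have -> : \prod_(j <- F2) \1_(A' j) (X j t) = \prod_(j <- F2) \1_(A j) (X j t) :> R.
    by apply: eq_big_seq => j jF; rewrite A'F.
  by congr EFin; ring.
rewrite IH.
- rewrite integral_indic//; last exact: (measurable_preX (fun=> B)).
  have PB : P (X i @^-1` B) = (p (fun=> B) i)%:E.
    rewrite /p fineK//; apply: fin_num_measure.
    exact: (measurable_preX (fun=> B)).
  rewrite setIT; transitivity (c%:E * (p (fun=> B) i)%:E)%E; last by rewrite -PB.
  rewrite -EFinM big_cons /c.
  have -> : p A' i = p (fun=> B) i by rewrite /p /A' eqxx.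
  have -> : \prod_(j <- F2) p A' j = \prod_(j <- F2) p A j :> R.
    by apply: eq_big_seq => j jF; rewrite /p A'F.
  by congr EFin; ring.
- by move: uF; rewrite -[i :: F2]cat1s uniq_catCA.
- by move=> j jF; apply: FS; rewrite -[i :: F1]cat1s -catA (perm_mem (permEl (perm_catCA _ _ _))).
- by move=> j; rewrite /A'; case: ifP.
- by move=> j jF; apply: fe; rewrite inE jF orbT.
Qed.

Lemma indep_integral_prod (F : seq I) (f : I -> R -> R) (e : I -> R) :
  uniq F -> (forall i, i \in F -> S i) ->
  (forall i, measurable_fun setT (f i)) -> (forall i x, 0 <= f i x) ->
  (forall i, i \in F -> \int[P]_t (f i (X i t))%:E = (e i)%:E)%E ->
  (\int[P]_t (\prod_(i <- F) f i (X i t))%:E = (\prod_(i <- F) e i)%:E)%E.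
Proof.
move=> uF FS mf f0 fe.
have := @indep_integral_prod_indic F [::] f e (fun=> setT).
rewrite cats0 big_nil mulr1 => <-//.
by apply: eq_integral => t _; rewrite big_nil mulr1.
Qed.

End independence.

(** * Bernstein's inequality *)

Lemma expR_ge_taylor2 (R : realType) (y : R) :
  0 <= y -> 1 + y + y ^+ 2 / 2 <= expR y.
Proof.
move=> y0; pose g (x : R) := expR x - (1 + x + x ^+ 2 / 2).
have dg (x : R) : is_derive x 1 g (expR x - (1 + x)).
  by apply: is_derive_eq; rewrite /GRing.scale/=; field.
suff : g 0 <= g y by rewrite /g expR0; lra.
apply: (@ger0_derive1_ndecry _ g 0) => //.
- by move=> x _; rewrite derive1E (@derive_val _ _ _ _ _ _ _ (dg x)) subr_ge0 expR_ge1Dx.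
- apply: derivable_within_continuous => x _; by case: (dg x).
Qed.

(** Inverting the Taylor lower bound at [- z] suffices, because [(1 - z + z^2/2) (1 + z + z^2/2) = 1
    + z^4/4 >= 1]. *)
Lemma expR_le_taylor2 (R : realType) (z : R) :
  z <= 0 -> expR z <= 1 + z + z ^+ 2 / 2.
Proof.
move=> z0; have zN : 0 <= - z by rewrite oppr_ge0.
have := @expR_ge_taylor2 R (- z) zN => h.
have p0 : 0 < 1 - z + (- z) ^+ 2 / 2 by nra.
apply: (@le_trans _ _ (1 - z + (- z) ^+ 2 / 2)^-1).
  by rewrite -[expR z]invrK -expRN lef_pV2 ?posrE ?expR_gt0.
by rewrite -div1r ler_pdivrMr//; nra.
Qed.

(* The right-hand side is the [2/1] Pade approximant of the exponential. *)
Lemma expR_le_pade (R : realType) (z : R) :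
  0 <= z -> expR z * (6 - 2 * z) <= 6 + 4 * z + z ^+ 2.
Proof.
(* Multiplying through by [expR (- x)] makes the sign of the derivative exactly the second-order
   Taylor bound. *)
move=> z0; pose g (x : R) := (6 + 4 * x + x ^+ 2) * expR (- x) - (6 - 2 * x).
have dg (x : R) : is_derive x 1 g (2 - (2 + 2 * x + x ^+ 2) * expR (- x)).
  by apply: is_derive_eq; rewrite /GRing.scale/=; ring.
have : g 0 <= g z.
  apply: (@ger0_derive1_ndecry _ g 0) => //.
  - move=> x; rewrite in_itv/= andbT => x0.
    rewrite derive1E (@derive_val _ _ _ _ _ _ _ (dg x)) subr_ge0 expRN ler_pdivrMr ?expR_gt0//.
    by have := @expR_ge_taylor2 R x (ltW x0); lra.
  - apply: derivable_within_continuous => x _; by case: (dg x).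
rewrite /g oppr0 expR0 => h; rewrite mulrC -ler_pdivlMr ?expR_gt0// -expRN.
lra.
Qed.

(** For [z <= 0] the Taylor bound is already stronger. For [z >= 0] the Pade quotient equals
    [1 + z + z^2 / (2 (1 - z/3))], which increases when [z] is replaced by [c] in the
    denominator. *)
Lemma expR_le_bernstein (R : realType) (z c : R) : z <= c -> 0 <= c < 3 ->
  expR z <= 1 + z + z ^+ 2 / (2 * (1 - c / 3)).
Proof.
move=> zc /andP[c0 c3].
have [z0|/ltW z0] := leP z 0.
  apply: (le_trans (expR_le_taylor2 _ _ z0)) => //.
  rewrite lerD2l ler_wpM2l ?sqr_ge0// lef_pV2 ?posrE; lra.
apply: (@le_trans _ _ (1 + z + z ^+ 2 / (2 * (1 - z / 3)))).
  have z3 : 0 < 6 - 2 * z by lra.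
  have := expR_le_pade R z z0; rewrite -ler_pdivlMr//.
  move=> /le_trans -> //; rewrite le_eqVlt; apply/orP; left; apply/eqP.
  by field; rewrite !gt_eqF//; lra.
rewrite lerD2l ler_wpM2l ?sqr_ge0// lef_pV2 ?posrE; lra.
Qed.

Section bernstein.
Context (d : measure_display) (T : measurableType d) (R : realType)
  (P : probability T R) (I : eqType) (S : set I) (X : I -> T -> R).
Hypothesis mX : forall i, measurable_fun setT (X i).
Hypothesis indepX : mutually_independent P S X.

(** The pointwise exponential bound is integrated, then [1 + x <= expR x] puts the result in a form
    whose products over indices only involve sums of first and second moments. *)
Lemma bernstein_mgf (i : I) (f : R -> R) (b theta : R) :
  measurable_fun setT f -> (forall t, f (X i t) <= b) ->
  P.-integrable setT (EFin \o (fun t => f (X i t))) ->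
  P.-integrable setT (EFin \o (fun t => f (X i t) ^+ 2)) ->
  0 < theta -> 0 < b -> theta * b < 3 ->
  exists2 m : R, (\int[P]_t (expR (theta * f (X i t)))%:E = m%:E)%E &
    0 <= m <= expR (theta * \int[P]_t f (X i t) +
      theta ^+ 2 / (2 * (1 - theta * b / 3)) * \int[P]_t (f (X i t)) ^+ 2).
Proof.
move=> mf fb if1 if2 th0 b0 thb.
set kap := theta ^+ 2 / _.
have mfX : measurable_fun setT (fun t => f (X i t)) by exact: measurableT_comp.
have mexp : measurable_fun setT (fun t => expR (theta * f (X i t))).
  by apply: measurableT_comp => //; exact: measurable_funM.
have i1 : P.-integrable setT (EFin \o cst (1 : R)).
  exact: finite_measure_integrable_cst.
have i2 : P.-integrable setT (EFin \o (fun t => theta * f (X i t))).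
  exact: (integrableZl measurableT theta if1).
have i3 : P.-integrable setT (EFin \o (fun t => kap * f (X i t) ^+ 2)).
  exact: (integrableZl measurableT kap if2).
have i12 : P.-integrable setT (EFin \o (fun t => 1 + theta * f (X i t))).
  exact: (integrableD measurableT i1 i2).
have i123 : P.-integrable setT
    (EFin \o (fun t => 1 + theta * f (X i t) + kap * f (X i t) ^+ 2)).
  exact: (integrableD measurableT i12 i3).
have ptw t : expR (theta * f (X i t)) <=
    1 + theta * f (X i t) + kap * f (X i t) ^+ 2.
  have := @expR_le_bernstein R (theta * f (X i t)) (theta * b).
  rewrite ler_pM2l// fb mulr_ge0 ?(ltW th0) ?(ltW b0)//= => /(_ isT thb).
  by rewrite exprMn mulrAC.
have iexp : P.-integrable setT (EFin \o (fun t => expR (theta * f (X i t)))).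
  apply: (le_integrable measurableT _ _ i123); first exact/measurable_EFinP.
  move=> t _ /=; rewrite lee_fin ger0_norm ?expR_ge0//.
  exact: le_trans (ptw t) (ler_norm _).
exists (\int[P]_t expR (theta * f (X i t))).
  by rewrite fineK//; exact: integrable_fin_num.
apply/andP; split; first by apply: Rintegral_ge0 => t _; exact: expR_ge0.
apply: (le_trans (@le_Rintegral _ _ _ P _ _ _ measurableT iexp i123 (fun t _ => ptw t))).
rewrite RintegralD// RintegralD// !RintegralZl// Rintegral_cst//.
set c := fine _; have -> : c = 1 by exact: (congr1 fine (probability_setT P)).
rewrite mulr1.
by rewrite -addrA expR_ge1Dx.
Qed.

(** Chernoff's method. The means enter only through their sum, so variables with distinct means can
    be centred at a common average. *)
Lemma bernstein (F : seq I) (f : I -> R -> R) (b V L : R) :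
  uniq F -> (forall i, i \in F -> S i) ->
  (forall i, measurable_fun setT (f i)) -> (forall i t, f i (X i t) <= b) ->
  (forall i, i \in F -> P.-integrable setT (EFin \o (fun t => f i (X i t)))) ->
  (forall i, i \in F ->
     P.-integrable setT (EFin \o (fun t => f i (X i t) ^+ 2))) ->
  0 < b -> 0 < V -> 0 < L ->
  \sum_(i <- F) \int[P]_t f i (X i t) <= 0 ->
  \sum_(i <- F) \int[P]_t (f i (X i t)) ^+ 2 <= V ->
  (P [set t | Num.sqrt (2 * V * L) + b * L / 3 < \sum_(i <- F) f i (X i t)]%R
     <= (expR (- L))%:E)%E.
Proof.
move=> uF FS mf fb if1 if2 b0 V0 L0 sum1 sum2.
(* With [w = 1 + u b / 3], the parameter [th = u / w] makes the Chernoff exponent equal to [- L]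
   exactly, since [u^2 V = 2 L] and [1 - th b / 3 = 1 / w]. *)
pose u := Num.sqrt (2 * L / V).
have u2 : u ^+ 2 * V = 2 * L.
  by rewrite sqr_sqrtr ?divr_ge0 ?mulr_ge0 ?ltW// divfK// gt_eqF.
have u0 : 0 < u by rewrite sqrtr_gt0 divr_gt0 ?mulr_gt0.
pose w := 1 + u * b / 3.
have w0 : 0 < w.
  rewrite /w; have ub0 : 0 < u * b by rewrite mulr_gt0.
  lra.
pose th := u / w.
have th0 : 0 < th by rewrite divr_gt0.
have wN0 : w != 0 by rewrite gt_eqF.
have ubw : u * b / 3 = w - 1 by rewrite /w; ring.
have thb : 1 - th * b / 3 = w^-1.
  rewrite (_ : th * b / 3 = (u * b / 3) / w); last by rewrite /th; field.
  by rewrite ubw; field.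
have thb3 : th * b < 3.
  have : 0 < w^-1 by rewrite invr_gt0.
  rewrite -thb; lra.
set s := Num.sqrt _ + _.
have sqrtE : Num.sqrt (2 * V * L) = u * V.
  by rewrite (_ : 2 * V * L = (u * V) ^+ 2) ?sqrtr_sqr ?ger0_norm ?mulr_ge0 ?ltW//; nra.
have expo : th ^+ 2 / (2 * (1 - th * b / 3)) * V - th * s = - L.
  rewrite /s sqrtE thb /th.
  have -> : (u / w) ^+ 2 / (2 * w^-1) * V = u ^+ 2 * V / (2 * w).
    by field.
  rewrite (_ : u / w * (u * V + b * L / 3) =
    u ^+ 2 * V / w + (u * b / 3) / w * L); last by field.
  by rewrite u2 ubw; field.
have /= mgf i : i \in F -> _ := fun iF =>
  bernstein_mgf i (f i) b th (mf i) (fb i) (if1 i iF) (if2 i iF) th0 b0 thb3.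
pose e i := fine (\int[P]_t (expR (th * f i (X i t)))%:E)%E.
have eE i : i \in F -> (\int[P]_t (expR (th * f i (X i t)))%:E = (e i)%:E)%E.
  by move=> /mgf[m me _]; rewrite /e me.
have prodE : (\int[P]_t (\prod_(i <- F) expR (th * f i (X i t)))%:E =
    (\prod_(i <- F) e i)%:E)%E.
  apply: (indep_integral_prod _ _ _ P I S X mX indepX F
    (fun i x => expR (th * f i x)) e) => //.
  - by move=> i; apply: measurableT_comp => //; exact: measurable_funM.
have mS : measurable_fun setT (fun t => \sum_(i <- F) f i (X i t)).
  by apply: measurable_sum => i; exact: measurableT_comp.
pose E := [set t | s < \sum_(i <- F) f i (X i t)].
have mE : measurable E.
  rewrite -[E]setTI; apply: measurable_fun_ltr => //; exact: measurable_cst.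
have prod_exp t : \prod_(i <- F) expR (th * f i (X i t)) =
    expR (th * \sum_(i <- F) f i (X i t)).
  by rewrite mulr_sumr expR_sum.
have markov : ((expR (th * s))%:E * P E <= (\prod_(i <- F) e i)%:E)%E.
  rewrite -prodE.
  have := @le_integral_abse _ _ _ P setT measurableT
    (fun t => (\prod_(i <- F) expR (th * f i (X i t)))%:E) (expR (th * s)).
  rewrite setTI.
  have prod0 t : 0 <= \prod_(i <- F) expR (th * f i (X i t)).
    by rewrite prodr_ge0// => i _; exact: expR_ge0.
  have -> : (\int[P]_t (\prod_(i <- F) expR (th * f i (X i t)))%:E =
      \int[P]_t `|(\prod_(i <- F) expR (th * f i (X i t)))%:E|)%E.
    by apply: eq_integral => t _; rewrite gee0_abs ?lee_fin.
  have mprod : measurable_fun setT (fun t => \prod_(i <- F) expR (th * f i (X i t))).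
    apply: measurable_prod => i _; apply: measurableT_comp => //.
    by apply: measurable_funM => //; exact: measurableT_comp.
  set A := [set x | _ <= `|_|]%E.
  have EA : E `<=` A.
    move=> t Et; rewrite /A/= lee_fin ger0_norm// prod_exp ler_expR ler_pM2l//.
    exact: ltW Et.
  have mA : measurable A.
    rewrite -[A]setTI; apply: emeasurable_fun_le => //.
    by apply: measurableT_comp => //; exact/measurable_EFinP.
  move=> /(_ _ (expR_gt0 _)) => h; apply: le_trans (h _); last exact/measurable_EFinP.
  apply: lee_wpmul2l; first by rewrite lee_fin expR_ge0.
  by apply: le_measure => //; exact: mem_set.
have prod_le : \prod_(i <- F) e i <=
    expR (th ^+ 2 / (2 * (1 - th * b / 3)) * V).
  apply: (@le_trans _ _ (\prod_(i <- F) expR (th * \int[P]_t f i (X i t) +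
      th ^+ 2 / (2 * (1 - th * b / 3)) * \int[P]_t (f i (X i t)) ^+ 2))).
    rewrite big_seq [leRHS]big_seq; apply: ler_prod => i /mgf[m me].
    by rewrite /e me.
  rewrite -expR_sum ler_expR big_split/= -!mulr_sumr.
  have k0 : 0 <= th ^+ 2 / (2 * (1 - th * b / 3)).
    by rewrite thb divr_ge0 ?sqr_ge0// mulr_ge0// invr_ge0 ltW.
  by rewrite -[leRHS]add0r lerD ?ler_wpM2l// mulr_ge0_le0// ltW.
have es0 : (0 < (expR (th * s))%:E)%E by rewrite lte_fin expR_gt0.
rewrite -(@lee_pmul2l R (expR (th * s))%:E erefl es0).
apply: (le_trans markov); rewrite -EFinM lee_fin -expRD.
by apply: (le_trans prod_le); rewrite ler_expR; move: expo; lra.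
Qed.
End bernstein.

(** * Events of high probability and the union bound *)

Section high_probability.
Context (d : measure_display) (T : measurableType d) (R : realType)
  (P : probability T R).

(** Phrased through a measurable event contained in [Q], so that it applies to predicates whose own
    measurability is not established. *)
Definition with_prob_ge (eps : R) (Q : T -> Prop) : Prop :=
  exists E : set T, [/\ measurable E, (1 - eps%:E <= P E)%E &
    forall t, E t -> Q t].

Lemma with_prob_ge_sub (eps : R) (Q Q' : T -> Prop) :
  (forall t, Q t -> Q' t) -> with_prob_ge eps Q -> with_prob_ge eps Q'.
Proof. by move=> QQ [E [mE PE EQ]]; exists E; split=> // t /EQ/QQ. Qed.

Lemma with_prob_geC (eps : R) (A : set T) : measurable A ->
  (P A <= eps%:E)%E -> with_prob_ge eps (fun t => ~ A t).
Proof.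
move=> mA PA; exists (~` A); split => //; first exact: measurableC.
by rewrite probability_setC// leeB.
Qed.

Lemma with_prob_ge_and (e1 e2 : R) (Q1 Q2 : T -> Prop) :
  with_prob_ge e1 Q1 -> with_prob_ge e2 Q2 ->
  with_prob_ge (e1 + e2) (fun t => Q1 t /\ Q2 t).
Proof.
move=> [E1 [mE1 PE1 EQ1]] [E2 [mE2 PE2 EQ2]].
exists (E1 `&` E2); split; first exact: measurableI.
  have PC E e : measurable E -> (1 - e%:E <= P E)%E -> (P (~` E) <= e%:E)%E.
    move=> mE; rewrite probability_setC// => h.
    by rewrite leeBlDr ?fin_num_measure// addeC -leeBlDr.
  rewrite -[E1 `&` E2]setCK setCI probability_setC; last first.
    by apply: measurableU; exact: measurableC.
  apply: leeB => //; rewrite EFinD.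
  apply: (le_trans (measureU2 _ _ _)); [exact: measurableC..|].
  by rewrite leeD// PC.
by move=> t [/EQ1 ? /EQ2].
Qed.

Lemma with_prob_ge_all (I : eqType) (s : seq I) (eps : R) (Q : I -> T -> Prop) :
  (forall i, i \in s -> with_prob_ge eps (Q i)) ->
  with_prob_ge ((size s)%:R * eps) (fun t => forall i, i \in s -> Q i t).
Proof.
elim: s => [_|i s IH wQ].
  by exists setT; split => //; rewrite mul0r sube0 probability_setT.
have := with_prob_ge_and _ _ _ _ (wQ i (mem_head _ _))
  (IH (fun j js => wQ j (@mem_behead _ (i :: s) j js))).
rewrite /= -natr1 mulrDl mul1r addrC.
apply: with_prob_ge_sub => t [Qi Qs] j; rewrite inE => /predU1P[->//|]; exact: Qs.
Qed.

End high_probability.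

(** * Concentration of sample mean and sample variance *)

Lemma bounded_integrable (d : measure_display) (T : measurableType d)
  (R : realType) (P : probability T R) (f : T -> R) (C : R) :
  measurable_fun setT f -> (forall t, `|f t| <= C) ->
  P.-integrable setT (EFin \o f).
Proof.
move=> mf fC; apply: measurable_bounded_integrable => //.
  by rewrite -ge0_fin_numE// fin_num_measure.
exists C; split; first exact: num_real.
by move=> y Cy t _ /=; rewrite (le_trans (fC t))// ltW.
Qed.

Section unit_interval.
Context (d : measure_display) (T : measurableType d) (R : realType)
  (P : probability T R) (I : eqType) (S : set I) (Z : I -> T -> R).
Hypothesis mZ : forall i, measurable_fun setT (Z i).
Hypothesis indepZ : mutually_independent P S Z.
Hypothesis Z01 : forall i t, 0 <= Z i t <= 1.
Variables (F : seq I) (L : R).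
Hypotheses (uF : uniq F) (FS : forall i, i \in F -> S i).
Hypotheses (F0 : (0 < size F)%N) (L0 : 0 < L).

Let N : R := (size F)%:R.
Let N0 : 0 < N. Proof. by rewrite ltr0n. Qed.
Let r := L / N.
Let r0 : 0 < r. Proof. by rewrite divr_gt0. Qed.

Definition avg (f : I -> R) : R := (size F)%:R^-1 * \sum_(i <- F) f i.

Lemma avgE (f : I -> R) : \sum_(i <- F) f i = N * avg f.
Proof. by rewrite /avg mulVKf// gt_eqF. Qed.

Lemma avg_cst (c : R) : avg (fun=> c) = c.
Proof. by rewrite /avg big_const_seq count_predT iter_addr_0 -[c *+ _]mulr_natl mulKf// gt_eqF. Qed.

Lemma avgD (f g : I -> R) : avg (fun i => f i + g i) = avg f + avg g.
Proof. by rewrite /avg big_split mulrDr. Qed.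

Lemma avgZ (c : R) (f : I -> R) : avg (fun i => c * f i) = c * avg f.
Proof. by rewrite /avg -mulr_sumr mulrCA. Qed.

Lemma avgN (f : I -> R) : avg (fun i => - f i) = - avg f.
Proof. by rewrite /avg sumrN mulrN. Qed.

Lemma le_avg (f g : I -> R) : (forall i, i \in F -> f i <= g i) -> avg f <= avg g.
Proof.
move=> fg; rewrite /avg ler_wpM2l ?invr_ge0 ?ler0n//.
by rewrite big_seq [leRHS]big_seq; apply: ler_sum.
Qed.

(** Bernstein's threshold with [V = N c], divided by [N], depends on [L] and [N] through [r = L / N]
    only. The two-sided bound [C] supplies integrability, while the one-sided bound [b] sets the
    linear term. *)
Lemma bernstein_avg (f : I -> R -> R) (b c C : R) :
  (forall i, measurable_fun setT (f i)) ->
  (forall i t, `|f i (Z i t)| <= C) ->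
  (forall i t, f i (Z i t) <= b) -> 0 < b -> 0 < c ->
  avg (fun i => \int[P]_t f i (Z i t)) <= 0 ->
  avg (fun i => \int[P]_t (f i (Z i t)) ^+ 2) <= c ->
  with_prob_ge _ _ _ P (expR (- L))
    (fun t => avg (fun i => f i (Z i t)) <= Num.sqrt (2 * c * r) + b * r / 3).
Proof.
move=> mf fC fb b0 c0 s1 s2.
have mfZ i : measurable_fun setT (fun t => f i (Z i t)).
  exact: measurableT_comp.
have := bernstein _ _ _ P I S Z mZ indepZ F f b (N * c) L uF FS mf fb.
move=> /(_ _ _ b0 (mulr_gt0 N0 c0) L0).
set A := [set t | _] => bern.
have mA : measurable A.
  rewrite -[A]setTI; apply: measurable_fun_ltr => //.
  by apply: measurable_sum => i; exact: mfZ.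
have /(with_prob_geC _ _ _ _ _ _ mA) : (P A <= (expR (- L))%:E)%E.
  apply: bern.
  - by move=> i _; apply: bounded_integrable (fC i) => //.
  - move=> i _; apply: (@bounded_integrable _ _ _ _ _ (C ^+ 2)).
      exact: measurable_funX.
    by move=> t; rewrite normrX lerXn2r ?nnegrE// (le_trans _ (fC i t)).
  - by rewrite avgE pmulr_rle0.
  - by rewrite avgE ler_pM2l.
apply: with_prob_ge_sub => t; rewrite /A /= => /negP; rewrite -leNgt avgE.
rewrite -(ler_pM2l N0 (avg _)) => /le_trans; apply.
rewrite mulrDr lerD//.
  rewrite -[X in X * Num.sqrt _](ger0_norm (ltW N0)) -sqrtr_sqr -sqrtrM ?sqr_ge0//.
  by rewrite ler_wsqrtr// /r le_eqVlt; apply/orP; left; apply/eqP; field; rewrite gt_eqF.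
by rewrite /r le_eqVlt; apply/orP; left; apply/eqP; field; rewrite gt_eqF.
Qed.

Let m i := \int[P]_t Z i t.
Let q i := \int[P]_t (Z i t) ^+ 2.

Let mbar := avg m.
Let alpha := avg (fun i => \int[P]_t (Z i t - mbar) ^+ 2).

Let int_Z i : P.-integrable setT (EFin \o Z i).
Proof.
apply: (bounded_integrable _ _ _ _ _ 1) => // t.
by have /andP[Z0 Z1] := Z01 i t; rewrite ger0_norm.
Qed.

Let int_Z2 i : P.-integrable setT (EFin \o (fun t => Z i t ^+ 2)).
Proof.
apply: (bounded_integrable _ _ _ _ _ 1); first exact: measurable_funX.
by move=> t; have /andP[Z0 Z1] := Z01 i t; rewrite ger0_norm ?sqr_ge0// expr_le1.
Qed.

Let int_cst (c : R) : P.-integrable setT (EFin \o (fun=> c)).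
Proof. exact: finite_measure_integrable_cst. Qed.

Let int_quad i (p0 p1 p2 : R) :
  P.-integrable setT (EFin \o (fun t => p0 + p1 * Z i t + p2 * Z i t ^+ 2)).
Proof.
have h1 := integrableD measurableT (int_cst p0) (integrableZl measurableT p1 (int_Z i)).
exact: (integrableD measurableT h1 (integrableZl measurableT p2 (int_Z2 i))).
Qed.

(** The means, the variances and the majorant of the fourth-order term are all integrals of
    quadratics in [Z i], so they reduce to [m] and [q]. *)
Let Rintegral_quad i (p0 p1 p2 : R) :
  \int[P]_t (p0 + p1 * Z i t + p2 * Z i t ^+ 2) = p0 + p1 * m i + p2 * q i.
Proof.
have h1 := integrableZl measurableT p1 (int_Z i).
have h2 := integrableZl measurableT p2 (int_Z2 i).
rewrite RintegralD//; last exact: (integrableD measurableT (int_cst p0) h1).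
rewrite RintegralD// !RintegralZl// Rintegral_cst//.
set c := fine _; have -> : c = 1 by exact: (congr1 fine (probability_setT P)).
by rewrite mulr1.
Qed.

Let Rintegral_quadE i (f : R -> R) (p0 p1 p2 : R) :
  (forall x, f x = p0 + p1 * x + p2 * x ^+ 2) ->
  \int[P]_t f (Z i t) = p0 + p1 * m i + p2 * q i.
Proof.
by move=> fE; rewrite -Rintegral_quad; apply: eq_Rintegral => t _; rewrite fE.
Qed.

Let Rintegral_quad_ge0 i (p0 p1 p2 : R) :
  (forall x, 0 <= x <= 1 -> 0 <= p0 + p1 * x + p2 * x ^+ 2) ->
  0 <= p0 + p1 * m i + p2 * q i.
Proof.
by move=> h; rewrite -Rintegral_quad; apply: Rintegral_ge0 => t _; exact: h.
Qed.

Let mbar01 : 0 <= mbar <= 1.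
Proof.
apply/andP; split.
  rewrite -(avg_cst 0); apply: le_avg => i _.
  by have := Rintegral_quad_ge0 i 0 1 0; rewrite mul0r addr0 add0r mul1r; apply=> x; lra.
rewrite -[leRHS](avg_cst 1); apply: le_avg => i _.
by have := Rintegral_quad_ge0 i 1 (-1) 0; rewrite mul0r addr0 mulN1r subr_ge0; apply=> x; lra.
Qed.

Let alphaE : alpha = avg q - mbar ^+ 2.
Proof.
rewrite /alpha.
under [avg _](_ : _ = avg (fun i => mbar ^+ 2 + (-2 * mbar) * m i + q i)).
  congr avg; apply/funext => i.
  rewrite (Rintegral_quadE i (fun x => (x - mbar) ^+ 2) (mbar ^+ 2) (-2 * mbar) 1) ?mul1r//.
  by move=> x; ring.
by rewrite avgD avgD avg_cst avgZ -/mbar; ring.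
Qed.

Lemma avg_variance_ge0 : 0 <= alpha.
Proof.
rewrite -(avg_cst 0); apply: le_avg => i _.
by apply: Rintegral_ge0 => t _; exact: sqr_ge0.
Qed.

(** On [[0, 1]] one has [x^2 <= x], hence [avg q <= mbar]. In particular [alpha <= 1/4]. *)
Lemma avg_variance_le : alpha <= mbar * (1 - mbar).
Proof.
have : avg q <= mbar.
  apply: le_avg => i _; rewrite -subr_ge0.
  have := Rintegral_quad_ge0 i 0 1 (-1); rewrite add0r mul1r mulN1r; apply => x; nra.
by rewrite alphaE; lra.
Qed.

(* Replacing [alpha] by [beta] keeps the variance proxies positive when [alpha = 0]. *)
Lemma unit_interval_concentration (beta := Num.max alpha r) :
  with_prob_ge _ _ _ P (4 * expR (- L)) (fun t =>
    [/\ `|avg (fun i => Z i t) - mbar| <= Num.sqrt (2 * beta * r) + r / 3,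
        avg (fun i => (Z i t - mbar) ^+ 2) <= alpha + Num.sqrt (2 * beta * r) + r / 3 &
        alpha - Num.sqrt (2 * beta * (1 - 3 * alpha) * r) - beta * r / 3 <=
          avg (fun i => (Z i t - mbar) ^+ 2)]).
Proof.
have /andP[mb0 mb1] := mbar01.
have al0 := avg_variance_ge0; have al1 := avg_variance_le.
have be_al : alpha <= beta by rewrite /beta le_max lexx.
have be0 : 0 < beta by rewrite /beta lt_max r0 orbT.
have al4 : alpha <= 1 / 4 by have := sqr_ge0 (mbar - 1 / 2); lra.
(* The square is at most [mbar^2 + (1 - mbar)^2 = 1 - 2 mbar (1 - mbar)], and
   [alpha <= mbar (1 - mbar)]. *)
have sq1 i t : (Z i t - mbar) ^+ 2 <= 1 - 2 * alpha.
  have /andP[z0 z1] := Z01 i t.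
  have h1 : 0 <= Z i t * (1 - Z i t) by rewrite mulr_ge0// subr_ge0.
  have h2 : 0 <= mbar * (1 - Z i t) by rewrite mulr_ge0// subr_ge0.
  have h3 : 0 <= (1 - mbar) * Z i t by rewrite mulr_ge0// subr_ge0.
  by nra.
have avgm1 (f : R -> R) (p0 p1 p2 : R) :
    (forall x, f x = p0 + p1 * x + p2 * x ^+ 2) ->
    avg (fun i => \int[P]_t f (Z i t)) = p0 + p1 * mbar + p2 * avg q.
  move=> fE; rewrite -[X in X + _ + _]avg_cst -!avgZ -!avgD; congr avg.
  by apply/funext => i; exact: Rintegral_quadE.
have mlin : measurable_fun setT (fun x : R => x - mbar).
  by apply: measurable_funB.
have msq : measurable_fun setT (fun x : R => (x - mbar) ^+ 2).
  exact: measurable_funX.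
have mZsq i : measurable_fun setT (fun t => (Z i t - mbar) ^+ 2).
  exact: (measurableT_comp msq (mZ i)).
have B1 : with_prob_ge _ _ _ P (expR (- L)) (fun t =>
    avg (fun i => Z i t - mbar) <= Num.sqrt (2 * beta * r) + r / 3).
  rewrite -[r / 3]mul1r mulrA.
  apply: (bernstein_avg (fun _ x => x - mbar) 1 beta 1) => //.
  - move=> i t; have /andP[z0 z1] := Z01 i t; rewrite ler_norml; lra.
  - move=> i t; have /andP[z0 z1] := Z01 i t; lra.
  - by rewrite (avgm1 (fun x => x - mbar) (- mbar) 1 0) => [|x]; [lra|ring].
have B2 : with_prob_ge _ _ _ P (expR (- L)) (fun t =>
    avg (fun i => - (Z i t - mbar)) <= Num.sqrt (2 * beta * r) + r / 3).
  rewrite -[r / 3]mul1r mulrA.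
  apply: (bernstein_avg (fun _ x => - (x - mbar)) 1 beta 1) => //.
  - move=> i; exact: measurableT_comp.
  - move=> i t; have /andP[z0 z1] := Z01 i t; rewrite ler_norml; lra.
  - move=> i t; have /andP[z0 z1] := Z01 i t; lra.
  - by rewrite (avgm1 (fun x => - (x - mbar)) mbar (-1) 0) => [|x]; [lra|ring].
  - apply: le_trans be_al; rewrite /alpha le_eqVlt; apply/orP; left; apply/eqP.
    congr avg; apply/funext => i; apply: eq_Rintegral => t _; ring.
(* For [0 <= y <= 1 - 2 alpha] one has [(y - alpha)^2 = alpha^2 + y (y - 2 alpha) <= alpha^2 + (1 -
   4 alpha) y]; with [y = (Z - mbar)^2], whose expectation averages to [alpha], the right side
   averages to [alpha (1 - 3 alpha)]. *)
have fourth : avg (fun i => \int[P]_t ((Z i t - mbar) ^+ 2 - alpha) ^+ 2) <=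
    alpha * (1 - 3 * alpha).
  have -> : alpha * (1 - 3 * alpha) = avg (fun i => \int[P]_t
      ((1 - 4 * alpha) * (Z i t - mbar) ^+ 2 + alpha ^+ 2)).
    rewrite (avgm1 (fun x => (1 - 4 * alpha) * (x - mbar) ^+ 2 + alpha ^+ 2)
      ((1 - 4 * alpha) * mbar ^+ 2 + alpha ^+ 2)
      (- 2 * (1 - 4 * alpha) * mbar) (1 - 4 * alpha)) => [|x]; last by ring.
    have -> : avg q = alpha + mbar ^+ 2 by rewrite alphaE subrK.
    by ring.
  apply: le_avg => i _; apply: le_Rintegral => //.
  - apply: (bounded_integrable _ _ _ _ _ 1).
      by apply: measurable_funX; exact: (measurable_funB (mZsq i)).
    move=> t; rewrite ger0_norm ?sqr_ge0//.
    have := sq1 i t; have := sqr_ge0 (Z i t - mbar); nra.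
  - apply: (bounded_integrable _ _ _ _ _ 2).
      by apply: measurable_funD => //; exact: measurable_funM.
    move=> t; have := sq1 i t; have := sqr_ge0 (Z i t - mbar).
    rewrite ler_norml; nra.
  - move=> t _; have := sq1 i t; have := sqr_ge0 (Z i t - mbar); nra.
have B3 : with_prob_ge _ _ _ P (expR (- L)) (fun t =>
    avg (fun i => (Z i t - mbar) ^+ 2 - alpha) <= Num.sqrt (2 * beta * r) + r / 3).
  rewrite -[r / 3]mul1r mulrA.
  apply: (bernstein_avg (fun _ x => (x - mbar) ^+ 2 - alpha) 1 beta 1) => //.
  - by move=> i; apply: measurable_funB.
  - move=> i t; have := sq1 i t; have := sqr_ge0 (Z i t - mbar).
    rewrite ler_norml; lra.
  - move=> i t; have := sq1 i t; lra.
  - rewrite (avgm1 (fun x => (x - mbar) ^+ 2 - alpha) (mbar ^+ 2 - alpha) (-2 * mbar) 1).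
      by rewrite alphaE; lra.
    by move=> x; ring.
  - by apply: (le_trans fourth); nra.
(* Here the variable is at most [alpha <= beta], far below 1 when the variance is small; this gives
   the linear term [beta r / 3] instead of [r / 3]. *)
have B4 : with_prob_ge _ _ _ P (expR (- L)) (fun t =>
    avg (fun i => - ((Z i t - mbar) ^+ 2 - alpha)) <=
      Num.sqrt (2 * (beta * (1 - 3 * alpha)) * r) + beta * r / 3).
  apply: (bernstein_avg (fun _ x => - ((x - mbar) ^+ 2 - alpha)) beta _ 1) => //.
  - by move=> i; apply: measurableT_comp => //; apply: measurable_funB.
  - move=> i t; have := sq1 i t; have := sqr_ge0 (Z i t - mbar).
    rewrite ler_norml; lra.
  - move=> i t; have := sqr_ge0 (Z i t - mbar); lra.
  - by rewrite mulr_gt0//; lra.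
  - rewrite (avgm1 (fun x => - ((x - mbar) ^+ 2 - alpha)) (alpha - mbar ^+ 2) (2 * mbar) (-1)).
      by rewrite alphaE; lra.
    by move=> x; ring.
  - rewrite (_ : avg _ = avg (fun i => \int[P]_t ((Z i t - mbar) ^+ 2 - alpha) ^+ 2)).
      by apply: (le_trans fourth); apply: ler_wpM2r => //; lra.
    congr avg; apply/funext => i; apply: eq_Rintegral => t _; ring.
have := with_prob_ge_and _ _ _ _ _ _ _ _ (with_prob_ge_and _ _ _ _ _ _ _ _ B1 B2)
  (with_prob_ge_and _ _ _ _ _ _ _ _ B3 B4).
rewrite (_ : _ + _ = 4 * expR (- L)); last by ring.
apply: with_prob_ge_sub => t [[H1 H2] [H3 H4]]; split.
- rewrite ler_norml; move: H1 H2; rewrite avgN avgD avg_cst; lra.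
- by move: H3; rewrite avgD avg_cst; lra.
- by move: H4; rewrite avgN avgD avg_cst !mulrA; lra.
Qed.

End unit_interval.

(** * From the concentration event to the sample standard deviation: deterministic inequalities *)

Lemma ler_of_sqr (R : realDomainType) (x y : R) :
  0 <= y -> x ^+ 2 <= y ^+ 2 -> x <= y.
Proof.
move=> y0 xy; have [x0|/ltW x0] := leP 0 x; last exact: le_trans x0 y0.
by rewrite -(@ler_pXn2r _ 2).
Qed.

(** Here [D] is the deviation of the sample mean, [S] the mean square about the true centre and [v]
    the sample standard deviation. The unknown variance in the bound on [D] is traded for [v]. *)
Lemma empirical_bernstein_lower (R : realType) (alpha r D S v : R)
  (beta := Num.max alpha r) :
  0 < r -> 0 <= alpha <= 1 / 4 -> 0 <= v -> S - D ^+ 2 <= v ^+ 2 -> 0 <= D ->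
  D <= Num.sqrt (2 * beta * r) + r / 3 ->
  alpha - Num.sqrt (2 * beta * (1 - 3 * alpha) * r) - beta * r / 3 <= S ->
  D <= v * Num.sqrt (2 * r) + 8 * r / 3.
Proof.
move=> r0 /andP[al0 al4] v0 Sv D0 Dle Sge.
have be0 : 0 < beta by rewrite /beta lt_max r0 orbT.
set s := Num.sqrt (2 * r); set tau := Num.sqrt beta.
have s0 : 0 < s by rewrite sqrtr_gt0 mulr_gt0.
have s2 : s ^+ 2 = 2 * r by rewrite sqr_sqrtr ?mulr_ge0 ?ltW.
have tau0 : 0 < tau by rewrite sqrtr_gt0.
have tau2 : tau ^+ 2 = beta by rewrite sqr_sqrtr ?ltW.
have -> : 8 * r / 3 = 4 / 3 * s ^+ 2 by rewrite s2; field.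
have Dle' : D <= tau * s + s ^+ 2 / 6.
  apply: (le_trans Dle); rewrite [2 * beta * r](_ : _ = beta * (2 * r)); last by ring.
  by rewrite sqrtrM ?(ltW be0)// -/s -/tau s2; lra.
have vs0 : 0 <= v * s by rewrite mulr_ge0// ltW.
(* The constant is [7/6 = 4/3 - 1/6]: since [D <= tau s + s^2 / 6] and the target is
   [v s + 4/3 s^2], it is enough that [tau - 7/6 s <= v]. *)
have [small|big] := leP tau (7 / 6 * s); first by move: small; rewrite -(ler_pM2r s0); lra.
(* If the maximum were [r], then [tau^2 = r = s^2 / 2], against [tau > 7/6 s]. *)
have beE : beta = alpha.
  rewrite /beta; case: leP => // h; exfalso.
  have ber : beta = r by rewrite /beta; apply/max_idPr.
  have : (7 / 6 * s) ^+ 2 < tau ^+ 2.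
    by rewrite ltrXn2r ?mulr_ge0 ?(ltW s0).
  by rewrite exprMn s2 tau2 ber; lra.
have tau4 : tau ^+ 2 <= 1 / 4 by rewrite tau2 beE.
(* The bound [sqrt (1 - x) <= 1 - x / 2] at [x = 3 alpha] leaves a polynomial inequality in [tau]
   and [s]. *)
have Sge' : tau ^+ 2 - tau * s * (1 - 3 / 2 * tau ^+ 2) - tau ^+ 2 * s ^+ 2 / 6 <= S.
  apply: le_trans Sge.
  have -> : Num.sqrt (2 * beta * (1 - 3 * alpha) * r) =
      tau * s * Num.sqrt (1 - 3 * alpha).
    rewrite -!sqrtrM ?mulr_ge0 ?(ltW be0) ?(ltW r0)//; congr Num.sqrt; ring.
  have : Num.sqrt (1 - 3 * alpha) <= 1 - 3 / 2 * tau ^+ 2.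
    rewrite -[leRHS]ger0_norm; last by lra.
    by rewrite -sqrtr_sqr ler_wsqrtr// tau2 beE; have := sqr_ge0 alpha; lra.
  have ts0 : 0 < tau * s by rewrite mulr_gt0.
  rewrite -(ler_pM2l ts0).
  have : beta * r / 3 = tau ^+ 2 * s ^+ 2 / 6 by rewrite tau2 s2; field.
  by rewrite -beE -tau2; lra.
have key : (tau - 7 / 6 * s) ^+ 2 <= v ^+ 2.
  have D2 : D ^+ 2 <= (tau * s + s ^+ 2 / 6) ^+ 2 by rewrite lerXn2r ?nnegrE// addr_ge0 ?mulr_ge0 ?divr_ge0 ?sqr_ge0 ?(ltW tau0) ?(ltW s0).
  apply: le_trans Sv.
  (* after division by [s], each power of [s] is bounded through [s < 6 tau / 7] *)
  suff : 49 / 36 * s + 7 / 6 * tau ^+ 2 * s + tau * s ^+ 2 / 3 + s ^+ 3 / 36 <=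
      4 / 3 * tau + 3 / 2 * tau ^+ 3.
    rewrite -(ler_pM2r s0); lra.
  have sle : s <= 6 / 7 * tau by lra.
  have h2 : s ^+ 2 <= (6 / 7 * tau) ^+ 2 by rewrite lerXn2r ?nnegrE ?mulr_ge0 ?(ltW s0) ?(ltW tau0).
  have h3 : s ^+ 3 <= (6 / 7 * tau) ^+ 3 by rewrite lerXn2r ?nnegrE ?mulr_ge0 ?(ltW s0) ?(ltW tau0).
  have h4 : tau ^+ 2 * s <= tau ^+ 2 * (6 / 7 * tau) by rewrite ler_pM2l ?exprn_gt0.
  have h5 : tau * s ^+ 2 <= tau * (6 / 7 * tau) ^+ 2 by rewrite ler_pM2l.
  have h6 : 0 < tau ^+ 3 by rewrite exprn_gt0.
  lra.
have : tau - 7 / 6 * s <= v by exact: ler_of_sqr.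
rewrite -(ler_pM2r s0); lra.
Qed.

(** Completing the square bounds [S] by [(tau + 4/3 rho)^2], where [tau] and [rho] are the roots of
    [alpha] and [r]; the correction [N / (N - 1)] of the unbiased variance then costs only another
    multiple of [r]. *)
Lemma empirical_variance_upper (R : realType) (alpha r N S D v : R)
  (beta := Num.max alpha r) :
  0 < r -> 0 <= alpha <= 1 / 4 -> 2 <= N -> 1 <= N * r -> 0 <= v ->
  (N - 1) * v ^+ 2 = N * (S - D ^+ 2) ->
  S <= alpha + Num.sqrt (2 * beta * r) + r / 3 ->
  v * Num.sqrt (2 * r) <= Num.sqrt alpha * Num.sqrt (2 * r) + 14 / 3 * r.
Proof.
move=> r0 /andP[al0 al4] N2 Nr v0 vE Sle.
set s := Num.sqrt (2 * r); set tau := Num.sqrt alpha; pose rho := Num.sqrt r.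
have s0 : 0 < s by rewrite sqrtr_gt0 mulr_gt0.
have s2 : s ^+ 2 = 2 * r by rewrite sqr_sqrtr ?mulr_ge0 ?ltW.
have tau0 : 0 <= tau by exact: sqrtr_ge0.
have tau2 : tau ^+ 2 = alpha by rewrite sqr_sqrtr.
have rho0 : 0 < rho by rewrite sqrtr_gt0.
have rho2 : rho ^+ 2 = r by rewrite sqr_sqrtr ?ltW.
have tau_half : tau <= 1 / 2.
  by apply: ler_of_sqr; rewrite // tau2; lra.
(* [142 / 100] is a rational upper bound for the square root of 2. *)
have srho : s <= 142 / 100 * rho.
  apply: ler_of_sqr; first by rewrite mulr_ge0// ltW.
  by rewrite exprMn rho2 s2; lra.
have sqrtb : Num.sqrt (2 * beta * r) <= s * (tau + rho).
  rewrite [2 * beta * r](_ : _ = 2 * r * beta); last by ring.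
  rewrite sqrtrM ?mulr_ge0 ?(ltW r0)// -/s ler_pM2l//.
  rewrite -[tau + rho]ger0_norm ?addr_ge0 ?(ltW rho0)// -sqrtr_sqr ler_wsqrtr//.
  have : 0 <= tau * rho by rewrite mulr_ge0// ltW.
  by rewrite sqrrD tau2 rho2 /beta ge_max; move=> tr0; apply/andP; split; lra.
(* The factor [4/3] is large enough because [142/100 + 1/3 <= 16/9]. *)
pose y := tau + 4 / 3 * rho.
have y0 : 0 < y by rewrite /y; lra.
have Sy : S <= y ^+ 2.
  have : s * (tau + rho) <= 142 / 100 * rho * (tau + rho) 
    by rewrite ler_wpM2r// addr_ge0// ltW.
  have : 0 <= tau * rho by rewrite mulr_ge0// ltW.
  rewrite /y; nra.
have N0 : 0 < N by lra.
have iN : N^-1 * N = 1 by rewrite mulVf// gt_eqF.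
have iN0 : 0 < N^-1 by rewrite invr_gt0.
(* This rests on [N / (N - 1) <= (1 + 1/N)^2], that is [N^2 - N - 1 >= 0], valid for [N >= 2]. *)
have vy : v <= (1 + N^-1) * y.
  apply: ler_of_sqr; first by rewrite mulr_ge0// ?(ltW y0) ?addr_ge0 ?(ltW iN0).
  have N1 : 0 < N - 1 by lra.
  rewrite -(ler_pM2l N1) vE exprMn mulrA.
  apply: (@le_trans _ _ (N * y ^+ 2)).
    by rewrite ler_pM2l//; move: Sy (sqr_ge0 D); lra.
  rewrite ler_pM2r ?exprn_gt0//.
  have hN : 0 <= (N - 2) * (N + 1) by apply: mulr_ge0; lra.
  have : 0 <= (N ^+ 2 - N - 1) * N^-1 ^+ 2.
    by apply: mulr_ge0; [lra|exact: sqr_ge0].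
  rewrite (_ : (N ^+ 2 - N - 1) * N^-1 ^+ 2 = (N - 1) * (1 + N^-1) ^+ 2 - N); first by lra.
  by field; rewrite gt_eqF.
have iNr : N^-1 <= r by rewrite -(ler_pM2l N0) mulfV ?gt_eqF.
have iN2 : N^-1 <= 1 / 2 by nra.
have iNrho : N^-1 <= rho.
  apply: ler_of_sqr; first exact: ltW.
  by rewrite rho2; nra.
(* Expanding [(1 + 1/N) y s] leaves [tau s] plus terms bounded by [0.71 r] and [2.84 r], within the
   allowed [14/3 r]. *)
have t1 : v * s <= (1 + N^-1) * y * s by rewrite ler_pM2r.
have t2 : tau * N^-1 * s <= 1 / 2 * rho * (142 / 100 * rho).
  apply: ler_pM => //; [by rewrite mulr_ge0// ltW|by exact: ltW|].
  by apply: ler_pM => //; exact: ltW.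
have t3 : (1 + N^-1) * (4 / 3 * rho) * s <= 2 * rho * (142 / 100 * rho).
  apply: ler_pM => //; [by rewrite !mulr_ge0// ltW//; lra|by exact: ltW|].
  rewrite mulrA ler_pM2r//; lra.
rewrite -rho2; move: t1 t2 t3; rewrite /y; have := exprn_gt0 2 rho0; lra.
Qed.

(** * Concentration on one window of [[a, b]]-valued samples, by rescaling to the unit interval *)

Lemma mutually_independent_comp (d : measure_display) (T : measurableType d)
  (R : realType) (P : probability T R) (I : eqType) (S : set I)
  (X : I -> T -> R) (g : I -> R -> R) :
  (forall i, measurable_fun setT (g i)) ->
  mutually_independent P S X ->
  mutually_independent P S (fun i t => g i (X i t)).
Proof.
move=> mg indepX F A uF FS mA.
apply: (indepX F (fun i => g i @^-1` A i)) => // i.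
by rewrite -[_ @^-1` _]setTI; exact: mg.
Qed.

(** Bias-variance identity, used for the sample variance and again for the spread of the period
    means. *)
Lemma sum_sqr_deviation (R : realType) (I : eqType) (F : seq I) (x : I -> R) (c : R) :
  (0 < size F)%N ->
  avg R I F (fun i => (x i - avg R I F x) ^+ 2) =
  avg R I F (fun i => (x i - c) ^+ 2) - (avg R I F x - c) ^+ 2.
Proof.
move=> F0; set y := avg R I F x.
rewrite [avg R I F (fun i => (x i - c) ^+ 2)](_ : _ =
  avg R I F (fun i => (x i - y) ^+ 2 + (2 * (y - c) * x i + (c ^+ 2 - y ^+ 2)))).
  by rewrite avgD avgD avgZ avg_cst// -/y; ring.
by congr avg; apply/funext => i; ring.
Qed.

Section window.
Context (d : measure_display) (T : measurableType d) (R : realType)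
  (P : probability T R) (I : eqType) (S : set I) (Y : I -> T -> R) (a b : R).
Hypothesis mY : forall i, measurable_fun setT (Y i).
Hypothesis indepY : mutually_independent P S Y.
Hypothesis Yab : forall i t, a <= Y i t <= b.
Hypothesis ab : a < b.

Let w := b - a.
Let w0 : 0 < w. Proof. by rewrite subr_gt0. Qed.
Let wN0 : w != 0. Proof. by rewrite gt_eqF. Qed.

Let Z i t := (Y i t - a) / w.

Let mZ i : measurable_fun setT (Z i).
Proof. by apply: measurable_funM => //; exact: measurable_funB. Qed.

Let Z01 i t : 0 <= Z i t <= 1.
Proof.
have /andP[h1 h2] := Yab i t.
apply/andP; split; first by rewrite divr_ge0 ?subr_ge0// ltW.
by rewrite ler_pdivrMr// mul1r lerB.
Qed.

Let indepZ : mutually_independent P S Z.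
Proof.
apply: (@mutually_independent_comp _ _ _ P I S Y (fun _ x => (x - a) / w)) => // i.
by apply: measurable_funM => //; exact: measurable_funB.
Qed.

Let iZ i : P.-integrable setT (EFin \o Z i).
Proof.
apply: (bounded_integrable _ _ _ _ _ 1) => // t.
by have /andP[? ?] := Z01 i t; rewrite ger0_norm.
Qed.

Variables (F : seq I) (L : R) (M V : I -> R).
Hypotheses (uF : uniq F) (FS : forall i, i \in F -> S i) (F1 : (1 < size F)%N).
Hypothesis L1 : 1 <= L.
Hypothesis meanY : forall i, i \in F -> \int[P]_t Y i t = M i.
Hypothesis varY : forall i, i \in F -> \int[P]_t (Y i t - M i) ^+ 2 = V i.

Let N : R := (size F)%:R.
Let Mbar := avg R I F M.
(** Variance of the pooled window: within-period variance plus spread of the period means. *)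
Let A := avg R I F (fun i => V i + (M i - Mbar) ^+ 2).

Let Rint_cst (c : R) : \int[P]_t c = c.
Proof.
rewrite Rintegral_cst//.
set k := fine _; have -> : k = 1 by exact: (congr1 fine (probability_setT P)).
by rewrite mulr1.
Qed.

Let icst (c : R) : P.-integrable setT (EFin \o (fun=> c)).
Proof. exact: finite_measure_integrable_cst. Qed.

Let iY i : P.-integrable setT (EFin \o Y i).
Proof.
have := integrableD measurableT (icst a) (integrableZl measurableT w (iZ i)).
apply: eq_integrable => // t _ /=; rewrite -EFinM -EFinD; congr EFin.
by rewrite /Z; field.
Qed.

Let iYc i (c : R) : P.-integrable setT (EFin \o (fun t => Y i t - c)).
Proof. exact: (integrableB measurableT (iY i) (icst c)). Qed.

Let iY2 i (c : R) : P.-integrable setT (EFin \o (fun t => (Y i t - c) ^+ 2)).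
Proof.
apply: (bounded_integrable _ _ _ _ _ ((`|a| + `|b| + `|c|) ^+ 2)).
  by apply: measurable_funX; exact: measurable_funB.
move=> t; rewrite normrX lerXn2r ?nnegrE ?addr_ge0//.
have /andP[h1 h2] := Yab i t.
have := ler_norm c; have := ler_norm (- c); have := ler_norm b; have := ler_norm (- a).
rewrite !normrN => ? ? ? ?; have := normr_ge0 a; have := normr_ge0 b.
by move=> ? ?; rewrite ler_norml; lra.
Qed.

Let meanZ i : i \in F -> \int[P]_t Z i t = (M i - a) / w.
Proof.
move=> iF; rewrite /Z RintegralZr; [|exact: measurableT|exact: iYc].
by rewrite RintegralB// Rint_cst meanY.
Qed.

Let F0 : (0 < size F)%N. Proof. exact: ltnW. Qed.

Let mbarZ : avg R I F (fun i => \int[P]_t Z i t) = (Mbar - a) / w.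
Proof.
rewrite (_ : avg _ _ _ _ = avg R I F (fun i => w^-1 * M i + (- a / w))).
  by rewrite avgD avgZ avg_cst// -/Mbar; field.
by rewrite /avg; congr (_ * _); apply: eq_big_seq => i iF; rewrite meanZ//; field.
Qed.

(** The square about [Mbar] is expanded about [M i], where the cross term integrates to zero. *)
Let alphaZ : avg R I F (fun i => \int[P]_t (Z i t - (Mbar - a) / w) ^+ 2) =
  A / w ^+ 2.
Proof.
rewrite [RHS]mulrC /A -avgZ /avg; congr (_ * _); apply: eq_big_seq => i iF.
have i1 : P.-integrable setT (EFin \o (fun t => (M i - Mbar) * 2 * (Y i t - M i))).
  exact: (integrableZl measurableT ((M i - Mbar) * 2) (iYc i (M i))).
have i2 : P.-integrable setT (EFin \o (fun t => (Y i t - M i) ^+ 2 +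
    (M i - Mbar) * 2 * (Y i t - M i))).
  exact: (integrableD measurableT (iY2 i _) i1).
have i3 : P.-integrable setT (EFin \o (fun t => (Y i t - M i) ^+ 2 +
    (M i - Mbar) * 2 * (Y i t - M i) + (M i - Mbar) ^+ 2)).
  exact: (integrableD measurableT i2 (icst _)).
transitivity (\int[P]_t ((w ^+ 2)^-1 * ((Y i t - M i) ^+ 2 +
    (M i - Mbar) * 2 * (Y i t - M i) + (M i - Mbar) ^+ 2))).
  by apply: eq_Rintegral => t _; rewrite /Z; field.
rewrite RintegralZl// RintegralD// RintegralD// RintegralZl//.
by rewrite RintegralB// !Rint_cst meanY// varY//; ring.
Qed.

(** The first half makes [psihat] a valid confidence radius; the second keeps its random part below
    population quantities. *)
Lemma window_concentration :
  with_prob_ge _ _ _ P (4 * expR (- L)) (fun t =>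
    let v := Num.sqrt ((N - 1)^-1 *
      \sum_(i <- F) (Y i t - avg R I F (fun i => Y i t)) ^+ 2) in
    `|avg R I F (fun i => Y i t) - Mbar| <=
      v * Num.sqrt (2 * L / N) + 8 * w * L / (3 * (N - 1)) /\
    v * Num.sqrt (2 * L / N) <=
      Num.sqrt A * Num.sqrt (2 * L / N) + 14 / 3 * w * L / N).
Proof.
have N2 : 2 <= N by rewrite (ler_nat _ 2).
have N0 : 0 < N by lra.
have NN0 : N != 0 by rewrite gt_eqF.
have L0 : 0 < L by exact: lt_le_trans ltr01 L1.
have r0 : 0 < L / N by rewrite divr_gt0.
have := unit_interval_concentration _ _ _ P I S Z mZ indepZ Z01 F L uF FS F0 L0.
have al0 := avg_variance_ge0 _ _ _ P I Z F F0.
have al1 := avg_variance_le _ _ _ P I Z mZ Z01 F F0.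
move: al0 al1; rewrite mbarZ alphaZ -/N.
set alpha := A / _; set mb := (Mbar - a) / w => al0 al1.
have al4 : 0 <= alpha <= 1 / 4.
  by rewrite al0/=; have := sqr_ge0 (mb - 1 / 2); lra.
apply: with_prob_ge_sub => t; set y := avg R I F (fun i => Y i t).
set z := avg R I F _; set Sz := avg R I F _ => -[H1 H2 H3] v.
pose vz := v / w.
have zE : z - mb = (y - Mbar) / w.
  rewrite /z (_ : (fun i => Z i t) = (fun i => w^-1 * Y i t + (- a / w))); last first.
    by apply/funext => i; rewrite /Z; field.
  by rewrite avgD avgZ avg_cst// -/y /mb; field.
have vz0 : 0 <= vz by rewrite divr_ge0 ?sqrtr_ge0 ?ltW.
(* The unbiased normalisation [N - 1] of the sample variance meets the averages [avg], normalised by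
   [N]. *)
have vzE : (N - 1) * vz ^+ 2 = N * (Sz - `|z - mb| ^+ 2).
  rewrite real_normK ?num_real// /Sz -sum_sqr_deviation// -/z.
  have N1 : N - 1 != 0 by rewrite gt_eqF//; lra.
  have s0 : 0 <= \sum_(i <- F) (Y i t - y) ^+ 2 by apply: sumr_ge0 => i _; exact: sqr_ge0.
  rewrite /vz expr_div_n /v sqr_sqrtr; last by rewrite mulr_ge0// invr_ge0; lra.
  rewrite -avgE// (_ : \sum_(i <- F) (Z i t - z) ^+ 2 =
    (w ^+ 2)^-1 * \sum_(i <- F) (Y i t - y) ^+ 2); last first.
    rewrite mulr_sumr; apply: eq_bigr => i _.
    have -> : z = (y - a) / w.
      by rewrite -[z](subrK mb) zE /mb; field.
    by rewrite /Z; field.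
  by field; rewrite N1 wN0.
have vzle : Sz - `|z - mb| ^+ 2 <= vz ^+ 2.
  by rewrite -(ler_pM2l N0) -vzE ler_wpM2r ?sqr_ge0//; lra.
have lower := empirical_bernstein_lower R alpha (L / N) `|z - mb| Sz vz
  r0 al4 vz0 vzle (normr_ge0 _) H1 H3.
have NrL : 1 <= N * (L / N) by rewrite mulrC divfK.
have upper := empirical_variance_upper R alpha (L / N) N Sz `|z - mb| vz
  r0 al4 N2 NrL vz0 vzE H2.
rewrite -!mulrA.
have vE : v = w * vz by rewrite /vz; field.
split.
  have -> : `|y - Mbar| = w * `|z - mb|.
    by rewrite zE normrM normfV (gtr0_norm w0) mulrC divfK.
  move: lower; rewrite -(ler_pM2l w0) => /le_trans; apply.
  rewrite mulrDr vE !mulrA lerD2l.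
  (* The bound obtained has denominator [3 N]; the one in [psihat] is smaller, so its linear term is
     larger. *)
  have : (3 * (N - 1))^-1 >= (3 * N)^-1.
    by rewrite lef_pV2 ?posrE; lra.
  have wL : 0 < 8 * w * L by rewrite !mulr_gt0.
  rewrite -(ler_pM2l wL); apply: le_trans.
  by rewrite le_eqVlt; apply/orP; left; apply/eqP; field.
have AE : Num.sqrt A = w * Num.sqrt alpha.
  have -> : A = w ^+ 2 * alpha by rewrite /alpha; field.
  by rewrite sqrtrM ?sqr_ge0// sqrtr_sqr gtr0_norm.
move: upper; rewrite -(ler_pM2l w0) vE AE mulrDr !mulrA.
by move=> /le_trans; apply; rewrite lerD2l le_eqVlt; apply/orP; left; apply/eqP; field.
Qed.

End window.

(** * Lepski selection over rolling windows *)

Section lepski.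
Context (R : realType) (x : nat -> nat -> R) (B : nat -> nat) (dl M : R) (t : nat).
Variables (m D : nat -> R) (m0 : R).
Local Notation mh := (muhat x B t).
Local Notation psi := (psihat x B dl M t).
Local Notation phi := (phihat x B dl M t).

Lemma phihat_ge0 k : 0 <= phi k.
Proof.
rewrite /phihat.
elim/big_ind : _ => // [y z y0 z0|i _]; first by rewrite le_max y0.
by rewrite le_max lexx orbT.
Qed.

Lemma phihat_ge k i : (1 <= i <= k)%N ->
  `|mh k - mh i| - (psi k + psi i) <= phi k.
Proof.
move=> ik; rewrite /phihat; apply: le_trans (le_bigmax_seq _ i _ _ _ isT).
  by rewrite le_max lexx.
by rewrite mem_index_iota.
Qed.

Hypothesis mh_near : forall k, (1 <= k <= t)%N -> `|mh k - m k| <= psi k.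
Hypothesis m_near : forall k, (1 <= k <= t)%N -> `|m k - m0| <= D k.
Hypothesis D_mono : forall i k, (i <= k)%N -> D i <= D k.

(** By the triangle inequality the excess over [psi k + psi i] is at most [D k + D i], and
    monotonicity of [D] gives [D i <= D k] for [i <= k]. *)
Lemma phihat_le k : (1 <= k <= t)%N -> phi k <= 2 * D k.
Proof.
move=> /andP[k1 kt].
have D0 : 0 <= D k by apply: le_trans (m_near k _) => //; rewrite k1.
rewrite /phihat big_seq; elim/big_ind : _ => [|y z y0 z0|i].
- by rewrite mulr_ge0.
- by rewrite ge_max y0.
rewrite mem_index_iota ltnS => /andP[i1 ik]; rewrite ge_max mulr_ge0// andbT.
have hk := mh_near k (introT andP (conj k1 kt)).
have hi := mh_near i (introT andP (conj i1 (leq_trans ik kt))).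
have gk := m_near k (introT andP (conj k1 kt)).
have gi := m_near i (introT andP (conj i1 (leq_trans ik kt))).
have Di := D_mono i k ik.
move: hk hi gk gi; rewrite !ler_norml => /andP[? ?] /andP[? ?] /andP[? ?] /andP[? ?].
by rewrite lerBlDr ler_norml; apply/andP; split; lra.
Qed.

Lemma lepski_selection khat k : arw_argmin x B dl M t khat -> (1 <= k <= t)%N ->
  `|mh khat - m0| <= 5 * D k + 3 * psi k.
Proof.
move=> [hkhat /(_ k) argmin] hk; have {}argmin := argmin hk.
have /andP[k1 kt] := hk; have /andP[kh1 kht] := hkhat.
(* The smaller of the two windows is among those tested in [phihat] of the larger one, so one of the
   two [phi] terms controls the difference and the other is nonnegative. *)
have compare : `|mh khat - mh k| <= (phi khat + psi khat) + (phi k + psi k).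
  have [le|/ltnW le] := leqP khat k.
    have := phihat_ge k khat; rewrite kh1 le distrC => /(_ isT).
    have := phihat_ge0 khat; lra.
  have := phihat_ge khat k; rewrite k1 le => /(_ isT).
  have := phihat_ge0 k; lra.
have := phihat_le k hk; have := mh_near k hk; have := m_near k hk.
move: compare; rewrite !ler_norml => /andP[? ?] /andP[? ?] /andP[? ?] ?.
by apply/andP; split; lra.
Qed.

End lepski.

(** * Windows as sequences of samples, and drift of the means *)

(** Listing (period, index) pairs turns the double sums of the statistics into sums over one
    duplicate-free sequence, the form required by [avg] and [mutually_independent]. *)
Definition window (B : nat -> nat) (t k : nat) : seq (nat * nat) :=
  [seq (j, i) | j <- index_iota (t - k + 1) t.+1, i <- index_iota 1 (B j).+1].

Section window_seq.
Context (R : realType) (B : nat -> nat) (t : nat).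

Lemma size_window k : size (window B t k) = Btk B t k.
Proof.
rewrite /window size_allpairs_dep sumnE big_map /Btk.
by apply: eq_bigr => j _; rewrite size_iota subn1.
Qed.

Lemma sum_window k (f : nat * nat -> R) :
  \sum_(ji <- window B t k) f ji =
  \sum_(t - k + 1 <= j < t.+1) \sum_(1 <= i < (B j).+1) f (j, i).
Proof. by rewrite /window big_allpairs_dep. Qed.

Lemma window_uniq k : uniq (window B t k).
Proof.
apply: allpairs_uniq_dep; first exact: iota_uniq.
  by move=> j _; exact: iota_uniq.
by move=> [j i] [j' i'] _ _ /= [-> ->].
Qed.

Lemma mem_window k ji : (k <= t)%N -> ji \in window B t k ->
  (1 <= ji.1 <= t)%N /\ (1 <= ji.2 <= B ji.1)%N.
Proof.
move=> kt /allpairsPdep[j [i [+ + ->]]] /=.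
rewrite !mem_index_iota !ltnS addn1 => /andP[j1 ->] ->; split => //.
by rewrite (leq_ltn_trans _ j1).
Qed.

Lemma muhat_avg (x : nat -> nat -> R) k :
  muhat x B t k = avg R _ (window B t k) (fun ji => x ji.1 ji.2).
Proof. by rewrite /muhat /window_sum /avg size_window sum_window. Qed.

Lemma vhat_avg (x : nat -> nat -> R) k :
  vhat x B t k = Num.sqrt (((size (window B t k))%:R - 1)^-1 *
    \sum_(ji <- window B t k)
      (x ji.1 ji.2 - avg R _ (window B t k) (fun ji => x ji.1 ji.2)) ^+ 2).
Proof. by rewrite /vhat size_window sum_window muhat_avg. Qed.

Lemma sigma2tk_avg (s : nat -> R) k :
  sigma2tk s B t k = avg R _ (window B t k) (fun ji => s ji.1).
Proof.
rewrite /sigma2tk /avg size_window sum_window; congr (_ * _).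
apply: eq_bigr => j _ /=.
by rewrite sumr_const_nat subn1 /= mulr_natl.
Qed.

Lemma Btk_gt0 k : (1 <= k <= t)%N -> (forall j, (1 <= j <= t)%N -> (1 <= B j)%N) ->
  (0 < Btk B t k)%N.
Proof.
move=> /andP[k1 kt] B1; rewrite /Btk big_nat_recr/=; last by rewrite addn1 ltn_subrL k1 (leq_trans k1).
by rewrite addn_gt0 (B1 t) ?orbT// leqnn (leq_trans k1).
Qed.

Lemma drift_mono (mu : nat -> R) i k : (i <= k)%N -> drift mu t i <= drift mu t k.
Proof. by move=> ik; apply: le_bigmax_nat => //; rewrite leq_add2r leq_sub2l. Qed.

Lemma drift_ge0 (mu : nat -> R) k : 0 <= drift mu t k.
Proof. by rewrite /drift; elim/big_ind : _ => // y z y0 z0; rewrite le_max y0. Qed.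

Lemma drift_ge (mu : nat -> R) k ji : ji \in window B t k ->
  `|mu ji.1 - mu t| <= drift mu t k.
Proof.
move=> /allpairsPdep[j [i [+ + ->]]] /= => jt _.
exact: (le_bigmax_seq _ j _ _ jt isT).
Qed.

Lemma avg_drift (mu : nat -> R) k : (0 < size (window B t k))%N ->
  `|avg R _ (window B t k) (fun ji => mu ji.1) - mu t| <= drift mu t k.
Proof.
move=> n0; rewrite ler_norml; set F := window B t k.
have h ji : ji \in F -> - drift mu t k <= mu ji.1 - mu t <= drift mu t k.
  by move=> /(drift_ge mu); rewrite ler_norml.
rewrite -[mu t](avg_cst R _ F n0) -avgN -avgD.
rewrite -[in - drift _ _ _](avg_cst R _ F n0 (drift mu t k)) -avgN.
rewrite -[X in _ && (_ <= X)](avg_cst R _ F n0 (drift mu t k)).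
by apply/andP; split; apply: le_avg => ji /h/andP[].
Qed.

(** The average [mb] minimises the mean squared deviation, so recentring at [mu t] can only enlarge
    it, and each term is then at most the squared drift. *)
Lemma avg_spread (mu : nat -> R) k (F := window B t k)
    (mb := avg R _ F (fun ji => mu ji.1)) : (0 < size F)%N ->
  avg R _ F (fun ji => (mu ji.1 - mb) ^+ 2) <= drift mu t k ^+ 2.
Proof.
move=> n0; rewrite (sum_sqr_deviation R _ F (fun ji => mu ji.1) (mu t) n0).
rewrite -[leRHS](avg_cst R _ F n0) lerBlDr ler_wpDr ?sqr_ge0//.
apply: le_avg => ji /(drift_ge mu) h.
by rewrite -(real_normK (num_real _)) lerXn2r ?nnegrE// drift_ge0.
Qed.

End window_seq.

(* Clamping turns the almost sure bounds on the samples into everywhere bounds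
   without changing laws or independence. *)
Definition clamp (R : realType) (a b x : R) : R := Num.max a (Num.min x b).

Section clamp.
Context (R : realType) (a b : R).
Hypothesis ab : a <= b.

Lemma clamp_itv x : a <= clamp R a b x <= b.
Proof. by rewrite /clamp le_max lexx ge_max ab ge_min lexx orbT. Qed.

Lemma clamp_id x : a <= x <= b -> clamp R a b x = x.
Proof. by move=> /andP[ax xb]; rewrite /clamp min_l// max_r. Qed.

Lemma measurable_clamp : measurable_fun setT (clamp R a b).
Proof. by apply: measurable_maxr => //; exact: measurable_minr. Qed.

(** The integral is moved to the law of [U], which is [Q]; there clamping is the identity almost
    everywhere. *)
Lemma Rintegral_clamp (d : measure_display) (T : measurableType d)
  (P : probability T R) (Q : probability R R) (U : {RV P >-> R})
  (h : R -> R) (C : R) :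
  Q `[a, b]%classic = 1%E ->
  (forall A, measurable A -> P (U @^-1` A) = Q A) ->
  measurable_fun setT h -> (forall x, a <= x <= b -> `|h x| <= C) ->
  \int[P]_t h (clamp R a b (U t)) = fine (\int[Q]_x (h x)%:E)%E.
Proof.
move=> Q1 PQ mh hC; rewrite /Rintegral; congr fine.
have mhc : measurable_fun setT (fun x => h (clamp R a b x)).
  by apply: measurableT_comp => //; exact: measurable_clamp.
transitivity (\int[distribution P U]_x (h (clamp R a b x))%:E)%E.
  rewrite integral_distribution//; first exact/measurable_EFinP.
  apply: (bounded_integrable _ _ _ _ _ C); first by apply: (measurableT_comp mhc).
  by move=> t; apply: hC; exact: clamp_itv.
transitivity (\int[Q]_x (h (clamp R a b x))%:E)%E.
  by apply: eq_measure_integral => A mA _; exact: PQ.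
apply: ae_eq_integral => //; [exact/measurable_EFinP..|].
exists (~` `[a, b]%classic); split.
- exact: measurableC.
- transitivity (1 - Q `[a, b]%classic)%E; last by rewrite Q1 subee.
  exact: probability_setC.
- by move=> x /= hx xab; apply: hx => _ /=; rewrite clamp_id//.
Qed.

Lemma with_prob_ge_itv (d : measure_display) (T : measurableType d)
  (P : probability T R) (Q : probability R R) (U : {RV P >-> R}) :
  Q `[a, b]%classic = 1%E ->
  (forall A, measurable A -> P (U @^-1` A) = Q A) ->
  with_prob_ge _ _ _ P 0 (fun t => clamp R a b (U t) = U t).
Proof.
move=> Q1 PQ; exists (U @^-1` `[a, b]%classic); split.
- by rewrite -[_ @^-1` _]setTI; exact: measurable_funP.
- by rewrite PQ// Q1 sube0.
- by move=> t /=; rewrite in_itv/= => /clamp_id.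
Qed.

End clamp.

(** * Oracle inequality for the adaptively selected window *)

Theorem mainTheorem6 (R : realType) (d : measure_display) (T : measurableType d)
  (P : probability T R) (a b : R) (t : nat) (B : nat -> nat)
  (Q : nat -> probability R R) (u : nat -> nat -> {RV P >-> R}) (delta : R) :
  a < b ->
  (0 < t)%N ->
  (forall j, (1 <= j <= t)%N -> (1 <= B j)%N) ->
  (forall j, (1 <= j <= t)%N -> Q j `[a, b]%classic = 1%E) ->
  (forall j i, (1 <= j <= t)%N -> (1 <= i <= B j)%N ->
     forall A, measurable A -> P (u j i @^-1` A) = Q j A) ->
  mutually_independent P
    [set ji : nat * nat | (1 <= ji.1 <= t)%N /\ (1 <= ji.2 <= B ji.1)%N]
    (fun ji => (u ji.1 ji.2 : T -> R)) ->
  0 < delta < 1 ->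
  let mu := fun j => dist_mean (Q j) in
  let sigma2 := fun j => dist_var (Q j) in
  let L := ln (6 * t%:R / delta) in
  exists E : set T, measurable E /\ (1 - delta%:E <= P E)%E /\
    forall w, E w ->
      forall khat, arw_argmin (fun j i => u j i w) B (delta / (3 * t%:R)) (b - a) t khat ->
        `|muhat (fun j i => u j i w) B t khat - mu t|
          <= 3 * min_range (fun k =>
                 3 * Num.sqrt L * drift mu t k
                 + Num.sqrt (sigma2tk sigma2 B t k) * Num.sqrt (2 * L / (Btk B t k)%:R)
                 + 10 * (b - a) * L / (Btk B t k)%:R) t.
Proof.
move=> ab t0 B1 Qab law indep /andP[de0 de1] mu sigma2 L.
have tR : 1 <= t%:R :> R by rewrite ler1n.
have tR0 : 0 < t%:R :> R by lra.
have lt6 : 0 < 6 * t%:R / delta by rewrite divr_gt0// mulr_gt0.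
have expNL : expR (- L) = delta / (6 * t%:R).
  by rewrite expRN lnK ?posrE// invf_div.
(* Since [6 t / delta >= 6], it is enough that [expR 1 <= 4], which follows from
   [expR (- 1/2) >= 1/2]. *)
have L1 : 1 <= L.
  have e4 : expR 1 <= 4 :> R.
    have h : 1 / 2 <= expR (- (1 / 2)) :> R by have := expR_ge1Dx (- (1 / 2) : R); lra.
    have k : expR (1 / 2) <= 2 :> R.
      rewrite -[expR _]invrK -expRN -[leRHS]invrK lef_pV2 ?posrE ?expR_gt0//.
      by move: h; lra.
    have -> : expR 1 = expR (1 / 2) * expR (1 / 2) :> R.
      by rewrite -expRD; congr expR; field.
    by have := expR_ge0 (1 / 2 : R); nra.
  rewrite -[leLHS]expRK ler_ln ?posrE ?expR_gt0//.
  apply: (le_trans e4); rewrite ler_pdivlMr//; nra.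
(* With [delta' = delta / (3 t)], the logarithm in [psihat] is exactly [L]. *)
have logE : ln (2 / (delta / (3 * t%:R))) = L.
  by rewrite /L; congr ln; field; rewrite !gt_eqF.
pose S := [set ji : nat * nat | (1 <= ji.1 <= t)%N /\ (1 <= ji.2 <= B ji.1)%N].
pose Y (ji : nat * nat) w := clamp R a b (u ji.1 ji.2 w).
have Yab ji w : a <= Y ji w <= b by apply: clamp_itv; exact: ltW.
have mY ji : measurable_fun setT (Y ji).
  by apply: measurableT_comp => //; exact: measurable_clamp.
have indepY : mutually_independent P S Y.
  apply: (@mutually_independent_comp _ _ _ P _ S (fun ji => (u ji.1 ji.2 : T -> R))
    (fun _ => clamp R a b)) => // _; exact: measurable_clamp.
have YE ji (h : R -> R) C : S ji -> measurable_fun setT h ->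
    (forall x, a <= x <= b -> `|h x| <= C) ->
    \int[P]_w h (Y ji w) = fine (\int[Q ji.1]_x (h x)%:E)%E.
  move=> [j1 j2] mh hC; apply: (Rintegral_clamp _ _ _ (ltW ab) _ _ _ _ _ _ C) => //.
    exact: Qab.
  exact: law.
have meanY ji : S ji -> \int[P]_w Y ji w = mu ji.1.
  move=> Sji; apply: (YE ji id (`|a| + `|b|)) => // x /andP[ax xb].
  have := ler_norm b; have := ler_norm (- a); rewrite normrN.
  by have := normr_ge0 a; have := normr_ge0 b; rewrite ler_norml; lra.
have mu_ab j : (1 <= j <= t)%N -> a <= mu j <= b.
  move=> jt; have Sj : S (j, 1%N) by split => //=; rewrite B1.
  have iY : P.-integrable setT (EFin \o Y (j, 1%N)).
    apply: (bounded_integrable _ _ _ _ _ (`|a| + `|b|)) => // w.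
    have := Yab (j, 1%N) w; have := ler_norm b; have := ler_norm (- a); rewrite normrN.
    by have := normr_ge0 a; have := normr_ge0 b; rewrite ler_norml; lra.
  have cstE (c : R) : \int[P]_w c = c.
    rewrite Rintegral_cst//.
    set k := fine _; have -> : k = 1 by exact: (congr1 fine (probability_setT P)).
    by rewrite mulr1.
  have icst (c : R) : P.-integrable setT (EFin \o (fun=> c)).
    exact: finite_measure_integrable_cst.
  rewrite -(meanY _ Sj) -{1}[a]cstE -[X in _ && (_ <= X)]cstE.
  by apply/andP; split; apply: le_Rintegral => // w _; have /andP[] := Yab (j, 1%N) w.
have varY ji : S ji -> \int[P]_w (Y ji w - mu ji.1) ^+ 2 = sigma2 ji.1.
  move=> Sji; have /andP[ma mb] := mu_ab _ (proj1 Sji).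
  apply: (YE ji (fun x => (x - mu ji.1) ^+ 2) ((b - a) ^+ 2)) => //.
    by apply: measurable_funX; exact: measurable_funB.
  move=> x /andP[ax xb]; rewrite normrX lerXn2r ?nnegrE ?subr_ge0 ?(ltW ab)//.
  by rewrite ler_norml; lra.
pose n k : R := (Btk B t k)%:R.
pose mb k := avg R _ (window B t k) (fun ji => mu ji.1).
pose A k := avg R _ (window B t k) (fun ji => sigma2 ji.1 + (mu ji.1 - mb k) ^+ 2).
(* A window with a single sample has no sample variance; its event is vacuous here and its radius
   [b - a] is handled deterministically below. *)
pose good k w := (1 < Btk B t k)%N ->
  let v := vhat (fun j i => Y (j, i) w) B t k in
  `|muhat (fun j i => Y (j, i) w) B t k - mb k| <=
     v * Num.sqrt (2 * L / n k) + 8 * (b - a) * L / (3 * (n k - 1)) /\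
  v * Num.sqrt (2 * L / n k) <=
     Num.sqrt (A k) * Num.sqrt (2 * L / n k) + 14 / 3 * (b - a) * L / n k.
have wp_good k : k \in index_iota 1 t.+1 ->
    with_prob_ge _ _ _ P (4 * expR (- L)) (good k).
  rewrite mem_index_iota ltnS => /andP[k1 kt].
  have FS ji : ji \in window B t k -> S ji by move=> /(mem_window _ _ _ _ kt).
  have [n1|n1] := ltnP 1 (Btk B t k).
    have F1 : (1 < size (window B t k))%N by rewrite size_window.
    have := window_concentration _ _ _ P _ S Y a b mY indepY Yab ab _ L
      (fun ji => mu ji.1) (fun ji => sigma2 ji.1) (window_uniq B t k) FS F1 L1
      (fun ji h => meanY ji (FS ji h)) (fun ji h => varY ji (FS ji h)).
    apply: with_prob_ge_sub => w /= h _; rewrite vhat_avg muhat_avg /= /n -size_window.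
    rewrite (_ : (fun ji => Y (ji.1, ji.2) w) = (fun ji => Y ji w)) //.
  exists setT; split => //; last by move=> w _; rewrite /good ltnNge n1.
  rewrite probability_setT leeBlDr// leeDl// lee_fin mulr_ge0// expR_ge0.
(* The window of length [t] contains every sample, so finitely many null events remove the clamping
   at no cost in probability. *)
have wp_itv ji : ji \in window B t t -> with_prob_ge _ _ _ P 0
    (fun w => Y ji w = u ji.1 ji.2 w).
  move=> /(mem_window _ _ _ _ (leqnn t)) [j1 j2].
  by apply: (with_prob_ge_itv _ _ _ _ _ _ (Q ji.1)); [exact: Qab|exact: law].
have [E [mE PE Egood]] := with_prob_ge_and _ _ _ _ _ _ _ _
  (with_prob_ge_all _ _ _ _ _ _ _ _ wp_good) (with_prob_ge_all _ _ _ _ _ _ _ _ wp_itv).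
exists E; split => //; split.
  (* The [t] windows cost [4 delta / (6 t)] each, in total [2/3 delta]. *)
  apply: le_trans PE; rewrite leeB// lee_fin size_iota subn1/= mulr0 addr0 expNL.
  rewrite (_ : t%:R * (4 * (delta / (6 * t%:R))) = 2 / 3 * delta); first lra.
  by field; rewrite gt_eqF.
move=> w /Egood[good_w itv_w] khat argmin.
pose x j i := u j i w.
have same k : (k <= t)%N -> {in window B t k, forall ji, Y ji w = x ji.1 ji.2}.
  move=> kt ji /(mem_window _ _ _ _ kt) [/andP[j1 j2] /andP[i1 i2]].
  apply: itv_w; apply/allpairsPdep; exists ji.1, ji.2.
  by rewrite !mem_index_iota !ltnS subnn j1 j2 i1 i2; split => //; case: (ji).
have avg_x k : (k <= t)%N -> avg R _ (window B t k) (fun ji => Y ji w) =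
    avg R _ (window B t k) (fun ji => x ji.1 ji.2).
  by move=> kt; rewrite /avg; congr (_ * _); apply: eq_big_seq; exact: same.
have muhat_x k : (k <= t)%N -> muhat (fun j i => Y (j, i) w) B t k = muhat x B t k.
  by move=> kt; rewrite !muhat_avg; exact: avg_x.
have vhat_x k : (k <= t)%N -> vhat (fun j i => Y (j, i) w) B t k = vhat x B t k.
  move=> kt; rewrite !vhat_avg; congr (Num.sqrt (_ * _)).
  apply: eq_big_seq => ji jiF.
  by rewrite -(same k kt ji jiF) -(avg_x k kt).
pose psi := psihat x B (delta / (3 * t%:R)) (b - a) t.
have n_gt0 k : (1 <= k <= t)%N -> (0 < Btk B t k)%N by move=> hk; exact: Btk_gt0.
have w0 : 0 < b - a by rewrite subr_gt0.
have good_x k : (1 <= k <= t)%N ->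
    `|muhat x B t k - mb k| <= psi k /\
    psi k <= Num.sqrt (sigma2tk sigma2 B t k) * Num.sqrt (2 * L / n k) +
      Num.sqrt L * drift mu t k + 10 * (b - a) * L / n k.
  move=> hk; have /andP[k1 kt] := hk; have nk0 := n_gt0 k hk.
  have Fk0 : (0 < size (window B t k))%N by rewrite size_window.
  have dr0 := drift_ge0 R t mu k; have sL0 := sqrtr_ge0 L.
  have sig0 := sqrtr_ge0 (sigma2tk sigma2 B t k).
  have [n1|n1] := ltnP 1 (Btk B t k); last first.
    (* With one sample, [muhat] and [mb k] both lie in [[a, b]], so [b - a] is a valid radius, and
       it is at most [10 (b - a) L] because [L >= 1]. *)
    have nE : n k = 1 by rewrite /n; have -> : Btk B t k = 1%N by apply/eqP; rewrite eqn_leq n1.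
    rewrite /psi /psihat n1; split.
      have between (f : nat * nat -> R) : (forall ji, ji \in window B t k -> a <= f ji <= b) ->
          a <= avg R _ (window B t k) f <= b.
        move=> fab; rewrite -{1}(avg_cst R _ _ Fk0 a) -[X in _ && (_ <= X)](avg_cst R _ _ Fk0 b).
        by apply/andP; split; apply: le_avg => ji /fab/andP[].
      have /andP[? ?] : a <= muhat x B t k <= b.
        by rewrite -muhat_x// muhat_avg; apply: between => ji _; exact: Yab.
      have /andP[? ?] : a <= mb k <= b.
        by apply: between => ji /(mem_window _ _ _ _ kt)[? _]; exact: mu_ab.
      by rewrite ler_norml; apply/andP; split; lra.
    rewrite nE !divr1.
    have h1 : 0 <= Num.sqrt L * drift mu t k by rewrite mulr_ge0.
    have h2 : 0 <= Num.sqrt (sigma2tk sigma2 B t k) * Num.sqrt (2 * L).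
      by rewrite mulr_ge0 ?sqrtr_ge0.
    have h3 : (b - a) * 1 <= (b - a) * L by rewrite ler_pM2l.
    lra.
  have kI : k \in index_iota 1 t.+1 by rewrite mem_index_iota ltnS k1.
  have := good_w k kI n1; rewrite /= muhat_x// vhat_x// => -[g1 g2].
  have psiE : psi k = vhat x B t k * Num.sqrt (2 * L / n k) +
      8 * (b - a) * L / (3 * (n k - 1)).
    by rewrite /psi /psihat leqNgt n1 /= logE.
  split; first by rewrite psiE.
  have n2 : 2 <= n k by rewrite (ler_nat _ 2).
  (* [n k >= 2] gives [n k - 1 >= n k / 2], so [8/3] becomes [16/3]; together with the [14/3] from
     the sample variance this makes the constant 10. *)
  have tail : 8 * (b - a) * L / (3 * (n k - 1)) <= 16 / 3 * (b - a) * L / n k.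
    have h : (3 * (n k - 1))^-1 <= 2 / 3 / n k.
      rewrite -[leRHS]invrK lef_pV2 ?posrE ?invr_gt0 ?divr_gt0//; [|lra..].
      by rewrite !invf_div; lra.
    have wL : 0 < 8 * (b - a) * L by rewrite !mulr_gt0//; lra.
    move: h; rewrite -(ler_pM2l wL) => /le_trans; apply.
    by rewrite le_eqVlt; apply/orP; left; apply/eqP; field; rewrite gt_eqF//; lra.
  (* [A k] exceeds [sigma2tk] by the spread of the means, at most the squared drift, and the square
     root is subadditive. *)
  have sA : Num.sqrt (A k) <= Num.sqrt (sigma2tk sigma2 B t k) + drift mu t k.
    apply: ler_of_sqr; first by rewrite addr_ge0.
    have s20 : 0 <= sigma2tk sigma2 B t k.
      rewrite sigma2tk_avg -(avg_cst R _ _ Fk0 0); apply: le_avg => ji /(mem_window _ _ _ _ kt) Sji.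
      by rewrite -varY//; apply: Rintegral_ge0 => z _; exact: sqr_ge0.
    have A0 : 0 <= A k.
      rewrite /A avgD -sigma2tk_avg addr_ge0// -(avg_cst R _ _ Fk0 0).
      by apply: le_avg => ji _; exact: sqr_ge0.
    rewrite sqr_sqrtr// sqrrD sqr_sqrtr//.
    have AE : A k = sigma2tk sigma2 B t k +
        avg R _ (window B t k) (fun ji => (mu ji.1 - mb k) ^+ 2).
      by rewrite /A avgD -sigma2tk_avg.
    have spread : avg R _ (window B t k) (fun ji => (mu ji.1 - mb k) ^+ 2) <=
        drift mu t k ^+ 2 by exact: avg_spread.
    rewrite AE.
    have : 0 <= Num.sqrt (sigma2tk sigma2 B t k) * drift mu t k by rewrite mulr_ge0.
    lra.
  (* As [n k >= 2], the drift part of [sqrt (A k)] is multiplied by at most [sqrt L]. *)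
  have s_le : Num.sqrt (2 * L / n k) <= Num.sqrt L.
    rewrite ler_wsqrtr// ler_pdivrMr; last by lra.
    by rewrite mulrC ler_wpM2l//; lra.
  have h1 : Num.sqrt (A k) * Num.sqrt (2 * L / n k) <=
      (Num.sqrt (sigma2tk sigma2 B t k) + drift mu t k) * Num.sqrt (2 * L / n k).
    by rewrite ler_wpM2r ?sqrtr_ge0.
  have h2 : drift mu t k * Num.sqrt (2 * L / n k) <= drift mu t k * Num.sqrt L.
    by rewrite ler_wpM2l.
  rewrite psiE.
  have -> : 10 * (b - a) * L / n k =
      14 / 3 * (b - a) * L / n k + 16 / 3 * (b - a) * L / n k.
    by field; rewrite gt_eqF//; lra.
  lra.
suff bound k : (1 <= k <= t)%N -> `|muhat x B t khat - mu t| <=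
    3 * (3 * Num.sqrt L * drift mu t k +
      Num.sqrt (sigma2tk sigma2 B t k) * Num.sqrt (2 * L / n k) +
      10 * (b - a) * L / n k).
  (* The default value of the minimum is its term at [k = 1], a genuine window because [t > 0]. *)
  rewrite /min_range -ler_pdivrMl// big_seq.
  apply: le_bigmin => [|k]; last rewrite mem_index_iota ltnS => hk.
    by rewrite ler_pdivrMl//; apply: bound; rewrite leqnn.
  by rewrite ler_pdivrMl//; exact: bound.
move=> hk.
have mb_near i : (1 <= i <= t)%N -> `|mb i - mu t| <= drift mu t i.
  by move=> hi; apply: avg_drift; rewrite size_window n_gt0.
have := lepski_selection R x B _ _ t mb (drift mu t) (mu t)
  (fun i hi => proj1 (good_x i hi)) mb_near (drift_mono R t mu) khat k argmin hk.
(* The selection bound leaves [5 drift + 3 sqrt L drift]; since [sqrt L >= 1] this is at most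
   [8 sqrt L drift], within the [9 sqrt L drift] of the statement. *)
have sL1 : 1 <= Num.sqrt L.
  by rewrite -[leLHS]sqrtr1 ler_wsqrtr.
have dr0 := drift_ge0 R t mu k.
have : 1 * drift mu t k <= Num.sqrt L * drift mu t k by rewrite ler_wpM2r.
have := proj2 (good_x k hk); rewrite -/psi.
lra.
Qed.
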